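(* For any irreducible cuspidal unitary automorphic representation $\pi$ of $GL(N)$ over $\mathbb{Q}$ the quantities $S_\infty(n,\pi)$ ($n\ge1$) are real-valued. There is a constant $K(\pi)$ such that for all integers $n\ge1$ with $n\ge K(\pi)$ there holds $$S_\infty(n,\pi)=\frac N2\,n\log n+C_1(\pi)\,n+O\bigl(N(K(\pi)+1)\bigr).$$ Here $$C_1(\pi)=\frac N2\bigl(\gamma-1-\log(2\pi)\bigr)+\frac12\log Q(\pi),$$ where $\gamma$ is Euler's constant (and in $\log(2\pi)$ the symbol $\pi$ is the number). One can take $$K(\pi)=\max_{1\le j\le N}|\kappa_j(\pi)|^2,$$ and the implied constant in the $O$-notation is absolute.
   Context: Let $\pi$ be an irreducible cuspidal unitary automorphic representation of $GL(N)$ over $\mathbb{Q}$ with conductor $Q(\pi)$ (a positive integer) and archimedean parameters $\kappa_1(\pi),\dots,\kappa_N(\pi)\in\mathbb{C}$, so that the archimedean factor of its completed standard $L$-function $\Lambda(s,\pi)=Q(\pi)^{s/2}L_\infty(s,\pi)L(s,\pi)$ is $L_\infty(s,\pi)=\prod_{j=1}^N\Gamma_{\mathbb{R}}(s+\kappa_j(\pi))$, where $\Gamma_{\mathbb{R}}(s)=\pi^{-s/2}\Gamma(s/2)$ (here $\pi$ is the number). Standing facts of the paper: $\Re(\kappa_j(\pi))>-\frac12$ for all $j$, and the multiset $\{\kappa_j(\pi):1\le j\le N\}$ is invariant under complex conjugation. The coefficients $\tau_n(\pi)$, $n\ge0$, are defined by the power series expansion around $s=0$ $$\sum_{n=0}^\infty\tau_n(\pi)s^n=\frac12\log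 Q(\pi)+\sum_{j=1}^N\frac{\Gamma_{\mathbb{R}}'}{\Gamma_{\mathbb{R}}}(s+1+\kappa_j(\pi)),$$ and for $n\ge1$, $S_\infty(n,\pi)=\sum_{j=1}^n\binom nj\tau_{j-1}(\pi)$. *)

(* Defs.v *)
From Stdlib Require Import Reals Factorial List Permutation ClassicalEpsilon.
From Coquelicot Require Import Coquelicot.

Open Scope R_scope.

Definition Cexp (z : C) : C :=
  (exp (Re z) * cos (Im z), exp (Re z) * sin (Im z)).

Definition Csum (l : list C) : C := fold_right Cplus (RtoC 0) l.

Fixpoint rising (z : C) (n : nat) : C :=
  match n with
  | O => RtoC 1
  | S m => (rising z m * (z + RtoC (INR m)))%C
  end.

(* n! n^z / (z (z+1) ... (z+n)), for n >= 1 *)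
Definition gauss_prod (z : C) (n : nat) : C :=
  (RtoC (INR (fact n)) * Cexp (z * RtoC (ln (INR n))) / rising z (S n))%C.

(* Gamma as the Euler-Gauss limit of [gauss_prod z], which converges at every z
   outside the poles 0, -1, -2, etc. *)
Definition CGamma (z : C) : C :=
  (real (Lim_seq (fun n => Re (gauss_prod z n))),
   real (Lim_seq (fun n => Im (gauss_prod z n)))).

(* pi ^ (- s / 2) = exp (- (s / 2) log pi) *)
Definition GammaR (s : C) : C :=
  (Cexp (- (s / RtoC 2) * RtoC (ln PI)) * CGamma (s / RtoC 2))%C.

(* [C_derive] is the complex derivative at points of complex differentiability
   ([C_derive_correct]); [GammaR] is holomorphic on the half-plane 0 < Re s,
   the only region where it is used below. *)
Definition Clogderiv (f : C -> C) (z : C) : C := (C_derive f z / f z)%C.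

Definition gamma_Euler : R :=
  real (Lim_seq (fun n => sum_n_m (fun k => / INR k) 1 n - ln (INR n))).

(* The part of an irreducible cuspidal unitary automorphic representation of GL(N)
   over Q on which tau_n and S_infty depend: the conductor and the multiset (here
   a list up to permutation) of archimedean parameters.  The last two fields are
   properties that hold for every such representation.  No other constraint is
   imposed, so every representation gives an element of this type. *)
Record automorphic_data (N : nat) : Type := AutomorphicData {
  conductor : nat;
  kappas : list C;
  conductor_pos : (0 < conductor)%nat;
  size_kappas : length kappas = N;
  Re_kappas : forall k : C, In k kappas -> - (1 / 2) < Re k;
  conj_kappas : Permutation (map Cconj kappas) kappas
}.
Arguments conductor {N} _.
Arguments kappas {N} _.
Arguments conductor_pos {N} _.
Arguments size_kappas {N} _.
Arguments Re_kappas {N} _.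
Arguments conj_kappas {N} _.

Definition tau_gen {N : nat} (p : automorphic_data N) (s : C) : C :=
  (RtoC (1 / 2 * ln (INR (conductor p)))
   + Csum (map (fun k : C => Clogderiv GammaR (s + RtoC 1 + k)) (kappas p)))%C.

Definition expands_at_0 (f : C -> C) (a : nat -> C) : Prop :=
  exists r : R, 0 < r /\
    forall s : C, Cmod s < r -> @is_pseries C_AbsRing C_NormedModule a s (f s).

(* The coefficient sequence of an expansion is unique when it exists, so [epsilon]
   picks the sequence (tau_n); nothing usable is known of it without existence. *)
Definition tau {N : nat} (p : automorphic_data N) : nat -> C :=
  epsilon (inhabits (fun _ : nat => RtoC 0)) (expands_at_0 (tau_gen p)).

(* [Binomial.C n j] is the binomial coefficient, as a real number. *)
Definition S_infty {N : nat} (n : nat) (p : automorphic_data N) : C :=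
  sum_n_m (fun j : nat => (RtoC (Binomial.C n j) * tau p (j - 1))%C) 1 n.

Definition C_1 {N : nat} (p : automorphic_data N) : R :=
  INR N / 2 * (gamma_Euler - 1 - ln (2 * PI)) + 1 / 2 * ln (INR (conductor p)).

(* The base value 0 does not affect the maximum, since |kappa|^2 >= 0 and the list
   is nonempty for N >= 1. *)
Definition K_const {N : nat} (p : automorphic_data N) : R :=
  fold_right Rmax 0 (map (fun k : C => Cmod k ^ 2) (kappas p)).

(* Main.v *)
Require Import Defs.
From Stdlib Require Import Reals.
From Coquelicot Require Import Coquelicot.
From Stdlib Require Import Lra Lia Factorial Permutation List ClassicalEpsilon.
Open Scope R_scope.

(** Put [w_k = 1 + kappa + 2 k].  The Euler-Gauss product for Gamma turns the
    logarithmic derivative of [GammaR] into a limit of finite sums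
    ([Clogderiv_GammaR]):
      [GammaR' / GammaR (1 + kappa + s)
         = lim_M (log (M / pi) / 2 - sum_(k <= M) 1 / (w_k + s))].
    Expanding each [1 / (w_k + s)] geometrically shows that the contribution of
    [kappa] to [tau_j] is the limit of [sum_(k <= M) (- 1 / w_k) ^ (j + 1)], with
    [log (M / pi) / 2] added when [j = 0] ([coef_expansion], [tau_eq]).  The
    binomial theorem then collapses the sum defining [S_infty]: up to
    [n log Q / 2] it is the sum over the parameters [kappa] of
      [T_n(kappa) = lim_M (n log (M / pi) / 2 + sum_(k <= M) ((1 - 1 / w_k) ^ n - 1))]
    ([S_infty_eq], [Clim_T_infty]).  Since [T_n] commutes with complex conjugation
    and the multiset of parameters is stable under it, [S_infty] is real.

    For the size of [T_n(kappa)], replace [w_k] by the real number [2 k + 2].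
    Because [Re w_k > 1/2], all the bases [1 - 1 / w_k] lie in the unit disc, so
    each of the [O(|kappa| + 1)] terms with [k] of the order of [|kappa|] or
    smaller changes by at most 2.  For the other [k], both bases are at most
    [x_k = 1 - c / (2 k + 2)] in modulus and differ by [O((|kappa| + 1) / k ^ 2)],
    which is [O(|kappa| + 1)] times [x_(k+1) - x_k]; the change of the [n]-th powers
    is therefore dominated by a telescoping sum of [x_(k+1) ^ n - x_k ^ n].
    Altogether the replacement costs [O(|kappa| + 1)], uniformly in [n]
    ([vpole_pow_sum_diff]).

    The remaining real sum has monotone terms in [[-1, 0]], so it differs by at most
    1 from the increment of an antiderivative of [(1 - 1 / (2 u)) ^ n - 1].  There
    is an explicit one, [Fref], built from [log u] and the truncated logarithmic
    series [sum_(j <= k) (1 - 1 / (2 u)) ^ j / j]; as [u] grows these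
    series tend to harmonic numbers, and [sum_(k < n) H_k = n H_n - n] produces
    [n log n] and Euler's constant ([T_infty_asymptotic]).  Finally
    [|kappa| + 1 <= 2 (|kappa| ^ 2 + 1)]. *)

(** * Limits of complex sequences *)

Definition Clim (u : nat -> C) (l : C) : Prop :=
  is_lim_seq (fun n => Re (u n)) (Re l) /\ is_lim_seq (fun n => Im (u n)) (Im l).

Definition Climit (u : nat -> C) : C :=
  (real (Lim_seq (fun n => Re (u n))), real (Lim_seq (fun n => Im (u n)))).

Lemma Clim_Climit u l : Clim u l -> Climit u = l.
Proof.
  intros [H1 H2]. apply is_lim_seq_unique in H1. apply is_lim_seq_unique in H2.
  unfold Climit. rewrite H1, H2. destruct l; reflexivity.
Qed.

Lemma Clim_unique u l l' : Clim u l -> Clim u l' -> l = l'.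
Proof. intros H H'. rewrite <- (Clim_Climit _ _ H). now apply Clim_Climit. Qed.

Lemma Climit_correct u : (exists l, Clim u l) -> Clim u (Climit u).
Proof. intros [l H]. now rewrite (Clim_Climit _ _ H). Qed.

Lemma Clim_ext u v l : (forall n, u n = v n) -> Clim u l -> Clim v l.
Proof.
  intros E [H1 H2]; split; eapply is_lim_seq_ext; eauto; intros n; now rewrite <- E.
Qed.

Lemma Clim_const c : Clim (fun _ => c) c.
Proof. split; apply is_lim_seq_const. Qed.

Lemma Clim_plus u v l m :
  Clim u l -> Clim v m -> Clim (fun n => (u n + v n)%C) (l + m)%C.
Proof. intros [] []; split; now apply is_lim_seq_plus'. Qed.

Lemma Clim_mult u v l m :
  Clim u l -> Clim v m -> Clim (fun n => (u n * v n)%C) (l * m)%C.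
Proof.
  intros [] []; split; simpl.
  - apply is_lim_seq_minus'; now apply is_lim_seq_mult'.
  - apply is_lim_seq_plus'; now apply is_lim_seq_mult'.
Qed.

Lemma Clim_opp u l : Clim u l -> Clim (fun n => (- u n)%C) (- l)%C.
Proof.
  intros H. apply Clim_ext with (fun n => (RtoC (-1) * u n)%C).
  { intros n; apply injective_projections; simpl; ring. }
  replace (- l)%C with (RtoC (-1) * l)%C
    by (apply injective_projections; simpl; ring).
  apply Clim_mult; [apply Clim_const | exact H].
Qed.

Lemma Clim_minus u v l m :
  Clim u l -> Clim v m -> Clim (fun n => (u n - v n)%C) (l - m)%C.
Proof. intros H H'. apply Clim_plus; [exact H | now apply Clim_opp]. Qed.

Lemma Clim_RtoC (u : nat -> R) (l : R) :
  is_lim_seq u l -> Clim (fun n => RtoC (u n)) (RtoC l).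
Proof. intros H; split; [exact H | apply is_lim_seq_const]. Qed.

Lemma Clim_Cmod u l : Clim u l -> is_lim_seq (fun n => Cmod (u n)) (Cmod l).
Proof.
  intros [H1 H2]. unfold Cmod.
  apply (is_lim_seq_continuous sqrt
           (fun n => fst (u n) ^ 2 + snd (u n) ^ 2)).
  { apply continuity_pt_sqrt. nra. }
  apply is_lim_seq_plus'.
  - apply is_lim_seq_mult'; [exact H1 | apply is_lim_seq_mult'; [exact H1|]].
    apply is_lim_seq_const.
  - apply is_lim_seq_mult'; [exact H2 | apply is_lim_seq_mult'; [exact H2|]].
    apply is_lim_seq_const.
Qed.

Lemma Clim_Cmod_le u l (B : R) :
  Clim u l -> (forall n, Cmod (u n) <= B) -> Cmod l <= B.
Proof.
  intros H HB. apply Clim_Cmod in H.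
  apply (is_lim_seq_le _ (fun _ => B) (Cmod l) B HB H (is_lim_seq_const B)).
Qed.

Lemma Im_le_Cmod (c : C) : Rabs (Im c) <= Cmod c.
Proof.
  eapply Rle_trans; [| apply Rmax_Cmod]. apply Rmax_r.
Qed.

Lemma Cmod_le_parts (c : C) : Cmod c <= Rabs (Re c) + Rabs (Im c).
Proof.
  apply Rsqr_incr_0_var.
  - unfold Rsqr. pose proof (Cmod2_alt c) as H. simpl in H. rewrite !Rmult_1_r in H.
    rewrite H. unfold Re, Im.
    pose proof (Rabs_pos (fst c)); pose proof (Rabs_pos (snd c)).
    pose proof (Rsqr_abs (fst c)) as E1; pose proof (Rsqr_abs (snd c)) as E2.
    unfold Rsqr in *. rewrite E1, E2. nra.
  - pose proof (Rabs_pos (Re c)); pose proof (Rabs_pos (Im c)); lra.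
Qed.

(** [u + v] is increasing and bounded, so [u] is a difference of convergent
    sequences. *)
Lemma ex_lim_seq_dominated (u v : nat -> R) :
  (forall n, Rabs (u (S n) - u n) <= v (S n) - v n) ->
  ex_finite_lim_seq v -> ex_finite_lim_seq u.
Proof.
  intros H [l Hl].
  assert (Hv : forall n, v n <= v (S n)).
  { intros n. specialize (H n). pose proof (Rabs_pos (u (S n) - u n)). lra. }
  assert (Hvl : forall n, v n <= l).
  { intros n. apply (is_lim_seq_incr_compare v l Hl Hv). }
  destruct (ex_finite_lim_seq_incr (fun n => u n + v n) (u 0%nat - v 0%nat + 2 * l))
    as [m Hm].
  - intros n. specialize (H n). apply Rabs_le_between in H. lra.
  - assert (Hu : forall n, u n <= u 0%nat + (v n - v 0%nat)).
    { induction n; [lra|]. specialize (H n). apply Rabs_le_between in H. lra. }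
    intros n. specialize (Hu n). specialize (Hvl n). lra.
  - exists (m - l). eapply is_lim_seq_ext; [| apply (is_lim_seq_minus' _ _ _ _ Hm Hl)].
    intros n; simpl; ring.
Qed.

Lemma ex_Clim_dominated (u : nat -> C) (v : nat -> R) :
  (forall n, Cmod (u (S n) - u n)%C <= v (S n) - v n) ->
  ex_finite_lim_seq v -> exists l, Clim u l.
Proof.
  intros H Hv.
  destruct (ex_lim_seq_dominated (fun n => Re (u n)) v) as [a Ha]; auto.
  { intros n. eapply Rle_trans; [| apply H].
    apply Rle_trans with (2 := re_le_Cmod _). simpl. apply Req_le. reflexivity. }
  destruct (ex_lim_seq_dominated (fun n => Im (u n)) v) as [b Hb]; auto.
  { intros n. eapply Rle_trans; [| apply H].
    apply Rle_trans with (2 := Im_le_Cmod _). simpl. apply Req_le. reflexivity. }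
  exists (a, b). now split.
Qed.

Lemma Cmod_minus_le a b : Cmod (a - b)%C <= Cmod a + Cmod b.
Proof.
  unfold Cminus. eapply Rle_trans; [apply Cmod_triangle |]. rewrite Cmod_opp; lra.
Qed.

(** * Finite sums and normally convergent products *)

Fixpoint csum (f : nat -> C) (n : nat) : C :=
  match n with O => RtoC 0 | S m => (csum f m + f m)%C end.

Fixpoint rsum (f : nat -> R) (n : nat) : R :=
  match n with O => 0 | S m => rsum f m + f m end.

Fixpoint cprod (f : nat -> C) (n : nat) : C :=
  match n with O => RtoC 1 | S m => (cprod f m * f m)%C end.

Lemma csum_S f n : csum f (S n) = (csum f n + f n)%C.
Proof. reflexivity. Qed.

Lemma csum_ext f g n : (forall k, (k < n)%nat -> f k = g k) -> csum f n = csum g n.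
Proof.
  induction n as [|n IH]; simpl; intros H; [reflexivity|].
  rewrite IH, H; auto.
Qed.

Lemma csum_plus f g n : csum (fun k => (f k + g k)%C) n = (csum f n + csum g n)%C.
Proof. induction n as [|n IH]; simpl; [ring | rewrite IH; ring]. Qed.

Lemma csum_scal c f n : csum (fun k => (c * f k)%C) n = (c * csum f n)%C.
Proof. induction n as [|n IH]; simpl; [ring | rewrite IH; ring]. Qed.

Lemma csum_Cmod_le f (g : nat -> R) n :
  (forall k, (k < n)%nat -> Cmod (f k) <= g k) -> Cmod (csum f n) <= rsum g n.
Proof.
  induction n as [|n IH]; simpl; intros H; [rewrite Cmod_0; lra|].
  eapply Rle_trans; [apply Cmod_triangle|]. apply Rplus_le_compat; auto.
Qed.

Lemma csum_exchange (f : nat -> nat -> C) m n :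
  csum (fun i => csum (fun j => f i j) n) m = csum (fun j => csum (fun i => f i j) m) n.
Proof.
  induction m as [|m IH]; simpl.
  - induction n as [|n IHn]; simpl; [reflexivity | rewrite <- IHn; ring].
  - now rewrite IH, csum_plus.
Qed.

Lemma csum_head f n : csum f (S n) = (f 0%nat + csum (fun k => f (S k)) n)%C.
Proof.
  induction n as [|n IH]; [simpl; ring|].
  change (csum f (S (S n))) with (csum f (S n) + f (S n))%C. rewrite IH. simpl; ring.
Qed.

Lemma Clim_csum (u : nat -> nat -> C) (l : nat -> C) n :
  (forall k, Clim (u k) (l k)) -> Clim (fun M => csum (fun k => u k M) n) (csum l n).
Proof.
  intros H. induction n as [|n IH]; simpl; [apply Clim_const | now apply Clim_plus].
Qed.

Lemma rsum_scal c f n : rsum (fun k => c * f k) n = c * rsum f n.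
Proof. induction n as [|n IH]; simpl; [ring | rewrite IH; ring]. Qed.

Lemma rsum_telescope f n : rsum (fun k => f (S k) - f k) n = f n - f 0%nat.
Proof. induction n as [|n IH]; simpl; [ring | rewrite IH; ring]. Qed.

(** The majorant [1 / ((k + 1) (k + 2))], comparable to [1 / (k + 1) ^ 2] and with
    telescoping partial sums. *)
Definition tel (k : nat) : R := / (INR k + 1) - / (INR k + 2).

Lemma tel_sum n : rsum tel n = 1 - / (INR n + 1).
Proof.
  induction n as [|n IH]; [simpl; field|].
  change (rsum tel (S n)) with (rsum tel n + tel n).
  rewrite IH, S_INR. unfold tel.
  replace (INR n + 1 + 1) with (INR n + 2) by ring. ring.
Qed.

Lemma tel_pos k : 0 < tel k.
Proof.
  unfold tel. pose proof (pos_INR k). apply Rlt_0_minus.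
  apply Rinv_lt_contravar; nra.
Qed.

Lemma tel_sum_bounds n : 0 <= rsum tel n <= 1.
Proof.
  rewrite tel_sum. pose proof (pos_INR n).
  assert (0 < / (INR n + 1)) by (apply Rinv_0_lt_compat; lra).
  assert (/ (INR n + 1) <= 1).
  { rewrite <- Rinv_1. apply Rinv_le_contravar; lra. }
  lra.
Qed.

Lemma inv_sqr_le_tel k : / (INR k + 1) ^ 2 <= 2 * tel k.
Proof.
  unfold tel. pose proof (pos_INR k).
  replace (2 * (/ (INR k + 1) - / (INR k + 2)))
    with (/ (INR k + 1) ^ 2 + INR k / ((INR k + 1) ^ 2 * (INR k + 2))) by (field; lra).
  assert (0 <= INR k / ((INR k + 1) ^ 2 * (INR k + 2))).
  { apply Rdiv_le_0_compat; [lra | nra]. }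
  lra.
Qed.

Lemma ex_lim_tel_sum c : ex_finite_lim_seq (fun n => c * rsum tel n).
Proof.
  destruct (ex_finite_lim_seq_incr (rsum tel) 1) as [l Hl].
  - intros n. simpl. pose proof (tel_pos n); lra.
  - intros n. apply tel_sum_bounds.
  - exists (c * l). apply (is_lim_seq_scal_l _ c l Hl).
Qed.

Lemma ex_Clim_csum f c : (forall k, Cmod (f k) <= c * tel k) -> exists l, Clim (csum f) l.
Proof.
  intros H. apply ex_Clim_dominated with (fun n => c * rsum tel n).
  - intros n. simpl.
    replace (csum f n + f n - csum f n)%C with (f n) by ring.
    specialize (H n). lra.
  - apply ex_lim_tel_sum.
Qed.

Lemma tel_majorant_ge0 (x : nat -> C) c :
  (forall k, Cmod (x k) <= c * tel k) -> 0 <= c.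
Proof.
  intros Hx. pose proof (Hx 0%nat); pose proof (tel_pos 0%nat); pose proof (Cmod_ge_0 (x 0%nat)).
  destruct (Rle_or_lt 0 c); [assumption|nra].
Qed.

Lemma cprod_Cmod_le (x : nat -> C) (c : R) (n : nat) :
  (forall k, Cmod (x k) <= c * tel k) ->
  Cmod (cprod (fun k => (RtoC 1 + x k)%C) n) <= exp c.
Proof.
  intros Hx. set (P := cprod (fun k => (RtoC 1 + x k)%C)).
  assert (H : Cmod (P n) <= exp (c * rsum tel n)).
  { induction n as [|n IH]; unfold P; simpl.
    - rewrite Cmod_1, Rmult_0_r, exp_0; lra.
    - rewrite Cmod_mult, Rmult_plus_distr_l, exp_plus.
      apply Rmult_le_compat; [apply Cmod_ge_0 | apply Cmod_ge_0 | exact IH |].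
      eapply Rle_trans; [apply Cmod_triangle|]. rewrite Cmod_1.
      pose proof (exp_ineq1_le (c * tel n)). specialize (Hx n). lra. }
  eapply Rle_trans; [exact H|]. pose proof (tel_sum_bounds n).
  pose proof (tel_majorant_ge0 x c Hx).
  destruct (Req_dec (c * rsum tel n) c) as [-> | E]; [lra|].
  left; apply exp_increasing. nra.
Qed.

Lemma cprod_sub1_le (x : nat -> C) (c : R) (n : nat) :
  (forall k, Cmod (x k) <= c * tel k) ->
  Cmod (cprod (fun k => (RtoC 1 + x k)%C) n - 1)%C <= exp c * c * rsum tel n.
Proof.
  intros Hx. set (P := cprod (fun k => (RtoC 1 + x k)%C)).
  induction n as [|n IH]; unfold P; simpl.
  - replace (1 - 1)%C with (RtoC 0) by ring. rewrite Cmod_0; lra.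
  - fold P.
    replace (P n * (1 + x n) - 1)%C with ((P n - 1) + P n * x n)%C by ring.
    eapply Rle_trans; [apply Cmod_triangle|]. rewrite Cmod_mult.
    pose proof (cprod_Cmod_le x c n Hx) as HP. fold P in HP. pose proof (Hx n).
    assert (Cmod (P n) * Cmod (x n) <= exp c * (c * tel n)).
    { apply Rmult_le_compat; auto using Cmod_ge_0. }
    lra.
Qed.

(** The error made when replacing the product by its linear part grows at step [n] by
    [(P n - 1) * x n], which is quadratic in [c].  With [c] proportional to an
    increment [s], this gives the first-order expansion of an infinite product
    in [s] with a remainder uniform in the number of factors. *)
Lemma cprod_linear (x : nat -> C) (c : R) (n : nat) :
  (forall k, Cmod (x k) <= c * tel k) ->
  Cmod (cprod (fun k => (RtoC 1 + x k)%C) n - 1 - csum x n)%C <= exp c * c ^ 2.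
Proof.
  intros Hx. pose proof (tel_majorant_ge0 x c Hx) as c_ge0.
  set (P := cprod (fun k => (RtoC 1 + x k)%C)).
  assert (H : Cmod (P n - 1 - csum x n)%C <= exp c * c ^ 2 * rsum tel n).
  { induction n as [|n IH]; unfold P; simpl.
    - replace (1 - 1 - 0)%C with (RtoC 0) by ring. rewrite Cmod_0; lra.
    - fold P.
      replace (P n * (1 + x n) - 1 - (csum x n + x n))%C
        with ((P n - 1 - csum x n) + (P n - 1) * x n)%C by ring.
      eapply Rle_trans; [apply Cmod_triangle|]. rewrite Cmod_mult.
      pose proof (cprod_sub1_le x c n Hx) as H1. fold P in H1. pose proof (Hx n).
      pose proof (tel_sum_bounds n). pose proof (exp_pos c).
      assert (Cmod (P n - 1)%C <= exp c * c).
      { eapply Rle_trans; [exact H1|].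
        assert (0 <= exp c * c) by (apply Rmult_le_pos; lra). nra. }
      assert (Cmod (P n - 1)%C * Cmod (x n) <= exp c * c * (c * tel n)).
      { apply Rmult_le_compat; auto using Cmod_ge_0. }
      lra. }
  eapply Rle_trans; [exact H|]. pose proof (tel_sum_bounds n).
  assert (0 <= exp c * c ^ 2).
  { apply Rmult_le_pos; [left; apply exp_pos | nra]. }
  nra.
Qed.

(** The increments [P n * x n] are dominated since the partial products are
    bounded. *)
Lemma ex_Clim_cprod (x : nat -> C) (c : R) :
  (forall k, Cmod (x k) <= c * tel k) ->
  exists l, Clim (cprod (fun k => (RtoC 1 + x k)%C)) l.
Proof.
  intros Hx. set (P := cprod (fun k => (RtoC 1 + x k)%C)).
  apply ex_Clim_dominated with (fun n => exp c * c * rsum tel n).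
  - intros n. unfold P; simpl; fold P.
    replace (P n * (1 + x n) - P n)%C with (P n * x n)%C by ring.
    rewrite Cmod_mult. pose proof (cprod_Cmod_le x c n Hx) as HP. fold P in HP. pose proof (Hx n).
    assert (Cmod (P n) * Cmod (x n) <= exp c * (c * tel n)).
    { apply Rmult_le_compat; auto using Cmod_ge_0. }
    lra.
  - apply ex_lim_tel_sum.
Qed.

(** * The complex exponential to second order *)

Lemma Cexp_plus a b : Cexp (a + b)%C = (Cexp a * Cexp b)%C.
Proof.
  unfold Cexp, Re, Im. apply injective_projections; simpl;
    rewrite exp_plus, ?cos_plus, ?sin_plus; ring.
Qed.

Lemma Cexp_0 : Cexp (RtoC 0) = RtoC 1.
Proof.
  unfold Cexp; apply injective_projections; simpl;
    rewrite exp_0, ?cos_0, ?sin_0; ring.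
Qed.

Lemma Cexp_neq0 z : Cexp z <> RtoC 0.
Proof.
  intros E. assert (H : (Cexp z * Cexp (- z))%C = RtoC 1).
  { rewrite <- Cexp_plus, <- Cexp_0. f_equal. ring. }
  rewrite E, Cmult_0_l in H. injection H. lra.
Qed.

Lemma Rabs_exp_sub1_le a : Rabs (exp a - 1) <= Rabs a * exp (Rabs a).
Proof.
  destruct (MVT_gen exp 0 a exp) as [c [Hc E]].
  - intros x _. apply is_derive_Reals, derivable_pt_lim_exp.
  - intros x _. apply derivable_continuous_pt, derivable_pt_exp.
  - rewrite exp_0 in E. rewrite E, Rabs_mult, Rminus_0_r.
    rewrite Rmult_comm. apply Rmult_le_compat_l; [apply Rabs_pos|].
    rewrite Rabs_right by (left; apply exp_pos).
    assert (Hle : c <= Rabs a).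
    { destruct Hc as [_ Hc]. pose proof (Rle_abs a). pose proof (Rabs_pos a).
      revert Hc. unfold Rmax. destruct (Rle_dec 0 a); lra. }
    destruct Hle as [Hlt | ->]; [left; now apply exp_increasing | lra].
Qed.

Lemma Rabs_exp_sub_le a : Rabs (exp a - 1 - a) <= a ^ 2 * exp (Rabs a).
Proof.
  destruct (MVT_gen (fun x => exp x - x) 0 a (fun x => exp x - 1)) as [c [Hc E]].
  - intros x _. auto_derive; [exact I | ring].
  - intros x _. apply derivable_continuous_pt. apply derivable_pt_minus.
    apply derivable_pt_exp. apply derivable_pt_id.
  - rewrite exp_0 in E.
    replace (exp a - 1 - a) with (exp a - a - (1 - 0)) by ring.
    rewrite E, Rabs_mult, Rminus_0_r.
    assert (Hle : Rabs c <= Rabs a).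
    { revert Hc. unfold Rmin, Rmax. destruct (Rle_dec 0 a); intros.
      - rewrite !Rabs_right; lra.
      - rewrite !Rabs_left1; lra. }
    assert (H1 : Rabs (exp c - 1) <= Rabs a * exp (Rabs a)).
    { eapply Rle_trans; [apply Rabs_exp_sub1_le|].
      apply Rmult_le_compat; try assumption; try apply Rabs_pos.
      - left; apply exp_pos.
      - destruct Hle as [Hlt | ->]; [left; now apply exp_increasing | lra]. }
    rewrite <- (pow2_abs a).
    apply Rle_trans with (Rabs a * exp (Rabs a) * Rabs a); [| right; ring].
    apply Rmult_le_compat_r; [apply Rabs_pos | exact H1].
Qed.

Lemma Rabs_sin_le b : Rabs (sin b) <= Rabs b.
Proof.
  destruct (MVT_gen sin 0 b cos) as [c [Hc E]].
  - intros x _. apply is_derive_Reals, derivable_pt_lim_sin.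
  - intros x _. apply derivable_continuous_pt, derivable_pt_sin.
  - rewrite sin_0, !Rminus_0_r in E. rewrite E, Rabs_mult.
    pose proof (COS_bound c). assert (Rabs (cos c) <= 1) by (apply Rabs_le; lra).
    pose proof (Rabs_pos b). nra.
Qed.

Lemma cos_sub1_le b : Rabs (cos b - 1) <= b ^ 2.
Proof.
  replace b with (2 * (b / 2)) at 1 by field.
  rewrite cos_2a_sin. pose proof (Rabs_sin_le (b / 2)) as H.
  pose proof (pow_incr _ _ 2 (conj (Rabs_pos _) H)) as H2.
  rewrite !pow2_abs in H2.
  replace (1 - 2 * sin (b / 2) * sin (b / 2) - 1) with (- (2 * sin (b / 2) ^ 2)) by ring.
  rewrite Rabs_Ropp, Rabs_right by nra. nra.
Qed.

Lemma sin_sub_le b : Rabs (sin b - b) <= b ^ 2.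
Proof.
  destruct (MVT_gen (fun x => sin x - x) 0 b (fun x => cos x - 1)) as [c [Hc E]].
  - intros x _. auto_derive; [exact I | ring].
  - intros x _. apply derivable_continuous_pt. apply derivable_pt_minus.
    apply derivable_pt_sin. apply derivable_pt_id.
  - rewrite sin_0 in E. replace (sin b - b) with (sin b - b - (0 - 0)) by ring.
    rewrite E, Rabs_mult, Rminus_0_r.
    assert (Hle : Rabs c <= Rabs b).
    { revert Hc. unfold Rmin, Rmax. destruct (Rle_dec 0 b); intros.
      - rewrite !Rabs_right; lra.
      - rewrite !Rabs_left1; lra. }
    assert (H1 : Rabs (cos c - 1) <= Rabs c).
    { replace c with (2 * (c / 2)) at 1 by field.
      rewrite cos_2a_sin. pose proof (Rabs_sin_le (c / 2)) as H.
      pose proof (SIN_bound (c / 2)) as H2. apply Rabs_le in H2.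
      replace (1 - 2 * sin (c / 2) * sin (c / 2) - 1)
        with (- (2 * (sin (c / 2) * sin (c / 2)))) by ring.
      rewrite Rabs_Ropp, !Rabs_mult, (Rabs_right 2) by lra.
      unfold Rdiv in H at 2. rewrite Rabs_mult, (Rabs_right (/ 2)) in H by lra.
      pose proof (Rabs_pos (sin (c / 2))). nra. }
    rewrite <- (pow2_abs b). pose proof (Rabs_pos b). nra.
Qed.

(** Real and imaginary part separately, from second-order bounds on [exp], [cos]
    and [sin]. *)
Lemma Cexp_quadratic u : Cmod (Cexp u - 1 - u)%C <= 3 * exp (Cmod u) * Cmod u ^ 2.
Proof.
  destruct u as [a b]. pose proof (Cmod2_alt (a, b)) as Hm. simpl Re in Hm; simpl Im in Hm.
  pose proof (re_le_Cmod (a, b)) as Ha. simpl in Ha.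
  set (m := Cmod (a, b)) in *.
  eapply Rle_trans; [apply Cmod_le_parts|]. simpl. rewrite Ropp_0, Rplus_0_r.
  set (e := exp (Rabs a)).
  assert (He : e <= exp m).
  { unfold e. destruct Ha as [Ha | ->]; [left; now apply exp_increasing | lra]. }
  assert (He1 : 1 <= e).
  { unfold e. pose proof (Rabs_pos a). pose proof (exp_ineq1_le (Rabs a)). lra. }
  assert (Hea : exp a <= e).
  { unfold e. destruct (Rle_abs a) as [H | E]; [left; now apply exp_increasing |].
    rewrite <- E; lra. }
  assert (H1 : Rabs (exp a * cos b + - (1) + - a) <= e * (a ^ 2 + b ^ 2)).
  { replace (exp a * cos b + - (1) + - a)
      with ((exp a - 1 - a) + exp a * (cos b - 1)) by ring.
    eapply Rle_trans; [apply Rabs_triang|].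
    rewrite Rabs_mult, (Rabs_right (exp a)) by (left; apply exp_pos).
    pose proof (Rabs_exp_sub_le a). fold e in H. pose proof (cos_sub1_le b).
    assert (exp a * Rabs (cos b - 1) <= e * b ^ 2).
    { apply Rmult_le_compat; auto using Rabs_pos. left; apply exp_pos. }
    lra. }
  assert (H2 : Rabs (exp a * sin b + - b) <= e * (Rabs a * Rabs b) + e * b ^ 2).
  { replace (exp a * sin b + - b) with ((exp a - 1) * sin b + (sin b - b)) by ring.
    eapply Rle_trans; [apply Rabs_triang|]. rewrite Rabs_mult.
    pose proof (Rabs_exp_sub1_le a). fold e in H. pose proof (Rabs_sin_le b).
    pose proof (sin_sub_le b).
    assert (Rabs (exp a - 1) * Rabs (sin b) <= Rabs a * e * Rabs b).
    { apply Rmult_le_compat; auto using Rabs_pos. }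
    assert (b ^ 2 <= e * b ^ 2) by (pose proof (pow2_ge_0 b); nra).
    lra. }
  assert (H3 : Rabs a * Rabs b <= a ^ 2 + b ^ 2).
  { rewrite <- (pow2_abs a), <- (pow2_abs b). nra. }
  assert (Hmm : 0 <= a ^ 2 + b ^ 2) by nra.
  apply Rle_trans with (3 * e * (a ^ 2 + b ^ 2)).
  - assert (e * (Rabs a * Rabs b) <= e * (a ^ 2 + b ^ 2)).
    { apply Rmult_le_compat_l; lra. }
    assert (e * b ^ 2 <= e * (a ^ 2 + b ^ 2)).
    { apply Rmult_le_compat_l; nra. }
    lra.
  - simpl in Hm |- *. rewrite Hm. apply Rmult_le_compat_r; [simpl in Hmm; lra | lra].
Qed.

(** * The Euler-Gauss product under translation *)

(** With the total [ln], the step [ln 1 - ln 0] vanishes, so that [ln n] is the sum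
    of the steps [lstep j] for [j < n], including [n = 0]. *)
Lemma ln_0 : ln 0 = 0.
Proof. unfold ln. destruct (Rlt_dec 0 0); [exfalso; lra | reflexivity]. Qed.

Definition lstep (j : nat) : R := ln (INR (S j)) - ln (INR j).

Lemma lstep_bounds j : / (INR (S j) + 1) <= lstep (S j) <= / INR (S j).
Proof.
  unfold lstep. set (x := INR (S j)). assert (Hx : 1 <= x).
  { unfold x; rewrite S_INR; pose proof (pos_INR j); lra. }
  replace (INR (S (S j))) with (x + 1) by (unfold x; now rewrite !S_INR).
  assert (Hln : forall t, - t < 1 -> ln (1 + t) <= t).
  { intros t Ht. rewrite <- (ln_exp t) at 2.
    apply Rcomplements.ln_le; [lra | apply exp_ineq1_le]. }
  split.
  - assert (Hi : 0 < / (x + 1)) by (apply Rinv_0_lt_compat; lra).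
    (* ln x is compared with ln (x + 1) through x = (x + 1) (1 - 1 / (x + 1)) *)
    assert (E : x = (x + 1) * (1 + - / (x + 1))) by (field; lra).
    assert (0 < 1 + - / (x + 1)) by nra.
    rewrite E at 3. rewrite ln_mult by lra.
    specialize (Hln (- / (x + 1))). lra.
  - assert (Hi : 0 < / x) by (apply Rinv_0_lt_compat; lra).
    replace (x + 1) with (x * (1 + / x)) by (field; lra).
    rewrite ln_mult by lra. specialize (Hln (/ x)). lra.
Qed.

Lemma lstep_0 : lstep 0 = 0.
Proof. unfold lstep. simpl. rewrite ln_1, ln_0. ring. Qed.

(** [lstep j] lies between [1 / (j + 1)] and [1 / j], hence within [O(1 / j ^ 2)] of
    [1 / (j + 1)].  This makes the products below normally convergent, and the
    sequence defining Euler's constant convergent. *)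
Lemma lstep_harmonic j : Rabs (lstep j - / (INR j + 1)) <= 4 * tel j.
Proof.
  pose proof (inv_sqr_le_tel j) as Ht.
  destruct j as [|j].
  - rewrite lstep_0. simpl in *.
    replace (0 - / (0 + 1)) with (- (1)) by field. rewrite Rabs_Ropp, Rabs_R1.
    replace (/ ((0 + 1) * ((0 + 1) * 1))) with 1 in Ht by field. lra.
  - pose proof (lstep_bounds j) as [H1 H2]. revert Ht H1 H2.
    generalize (lstep (S j)). set (x := INR (S j)). intros l Ht H1 H2.
    assert (Hx : 1 <= x) by (unfold x; rewrite S_INR; pose proof (pos_INR j); lra).
    rewrite Rabs_right by lra.
    assert (E : 2 * / (x + 1) ^ 2 - (/ x - / (x + 1)) = (x - 1) / (x * (x + 1) ^ 2)).
    { field; lra. }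
    assert (0 <= (x - 1) / (x * (x + 1) ^ 2)) by (apply Rdiv_le_0_compat; nra).
    lra.
Qed.

Lemma lstep_le j : 0 <= lstep j <= 2 * / (INR j + 1).
Proof.
  destruct j as [|j].
  - rewrite lstep_0. simpl. lra.
  - pose proof (lstep_bounds j) as [H1 H2]. revert H1 H2.
    generalize (lstep (S j)). set (x := INR (S j)). intros l H1 H2.
    assert (Hx : 1 <= x) by (unfold x; rewrite S_INR; pose proof (pos_INR j); lra).
    assert (0 < / (x + 1)) by (apply Rinv_0_lt_compat; lra).
    assert (E : 2 * / (x + 1) - / x = (x - 1) / (x * (x + 1))) by (field; lra).
    assert (0 <= (x - 1) / (x * (x + 1))) by (apply Rdiv_le_0_compat; nra).
    lra.
Qed.

Definition pole (z : C) (j : nat) : C := (z + RtoC (INR j + 1))%C.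

(** The factor of index [j] in the quotient of the Gauss products at [z + s] and at
    [z], once [n ^ s] has been split into [exp (s * lstep j)]. *)
Definition gfac (z s : C) (j : nat) : C :=
  (pole z j / pole (z + s) j * Cexp (s * RtoC (lstep j)))%C.

(** The first-order coefficient of [gfac z s j] in [s]. *)
Definition glin (z : C) (j : nat) : C := (RtoC (lstep j) - / pole z j)%C.

Lemma Cmod_pole_ge z j : 0 <= Re z -> INR j + 1 <= Cmod (pole z j).
Proof.
  intros H. eapply Rle_trans; [| apply re_le_Cmod].
  eapply Rle_trans; [| apply Rle_abs]. unfold Re in *; simpl; lra.
Qed.

Lemma pole_neq0 z j : 0 <= Re z -> pole z j <> RtoC 0.
Proof.
  intros H. apply Cmod_gt_0. pose proof (Cmod_pole_ge z j H). pose proof (pos_INR j). lra.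
Qed.

Lemma glin_Cmod_le z j : 0 <= Re z -> Cmod (glin z j) <= (4 + 2 * Cmod z) * tel j.
Proof.
  intros H. pose proof (pos_INR j) as Hj.
  assert (E : glin z j = (RtoC (lstep j - / (INR j + 1))
                          + z * (/ pole z j * RtoC (/ (INR j + 1))))%C).
  { unfold glin. rewrite RtoC_minus, RtoC_inv by lra.
    pose proof (pole_neq0 z j H) as Hp. unfold pole in *.
    field. split; [intros E; injection E; lra | exact Hp]. }
  rewrite E. eapply Rle_trans; [apply Cmod_triangle|].
  rewrite Cmod_R, !Cmod_mult, Cmod_R, Cmod_inv by now apply pole_neq0.
  pose proof (Cmod_pole_ge z j H) as Hp. pose proof (lstep_harmonic j).
  assert (Hi : 0 < / (INR j + 1)) by (apply Rinv_0_lt_compat; lra).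
  rewrite (Rabs_right (/ (INR j + 1))) by lra.
  assert (/ Cmod (pole z j) * / (INR j + 1) <= 2 * tel j).
  { eapply Rle_trans; [| apply inv_sqr_le_tel]. simpl. rewrite Rmult_1_r, Rinv_mult.
    apply Rmult_le_compat_r; [lra|]. apply Rinv_le_contravar; lra. }
  pose proof (Cmod_ge_0 z). nra.
Qed.

(** The numerator of [gfac z s j - 1] is [exp (s l) - 1 - s / pole], and replacing
    [exp (s l)] by [1 + s l] leaves [s * glin]; both errors are [O(s ^ 2 / j ^ 2)]. *)
Lemma gfac_quadratic z s j : 0 <= Re z -> 0 <= Re (z + s)%C ->
  Cmod (gfac z s j - 1 - s * glin z j)%C
  <= ((Cmod z + 1) * (24 * exp (2 * Cmod s)) + (4 + 2 * Cmod z)) * Cmod s ^ 2 * tel j.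
Proof.
  intros Hz Hs. pose proof (pos_INR j) as Hj.
  pose proof (pole_neq0 z j Hz) as Np. pose proof (pole_neq0 _ j Hs) as Nq.
  pose proof (Cmod_pole_ge _ j Hs) as Hq.
  pose proof (Cmod_ge_0 z) as Hz0. pose proof (Cmod_ge_0 s) as Hs0.
  pose proof (glin_Cmod_le z j Hz) as Hl. pose proof (tel_pos j) as Ht.
  assert (Eq : pole (z + s) j = (pole z j + s)%C) by (unfold pole; ring).
  set (r := (Cexp (s * RtoC (lstep j)) - 1 - s * RtoC (lstep j))%C).
  assert (E : (gfac z s j - 1 - s * glin z j)%C
    = (pole z j / pole (z + s) j * r - s * glin z j * (s / pole (z + s) j))%C).
  { unfold gfac, r, glin. rewrite Eq in *. field. split; assumption. }
  rewrite E. eapply Rle_trans; [apply Cmod_minus_le|].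
  rewrite !Cmod_mult, Cmod_div, Cmod_div by assumption.
  assert (Hr : Cmod r <= 24 * exp (2 * Cmod s) * Cmod s ^ 2 * tel j).
  { unfold r. eapply Rle_trans; [apply Cexp_quadratic|].
    rewrite Cmod_mult, Cmod_R. destruct (lstep_le j) as [L0 L1].
    rewrite (Rabs_right (lstep j)) by lra.
    assert (Hi : 0 < / (INR j + 1)) by (apply Rinv_0_lt_compat; lra).
    assert (/ (INR j + 1) <= 1) by (rewrite <- Rinv_1; apply Rinv_le_contravar; lra).
    assert (Hexp : exp (Cmod s * lstep j) <= exp (2 * Cmod s)).
    { assert (Hle : Cmod s * lstep j <= 2 * Cmod s) by nra.
      destruct Hle as [Hlt | ->]; [left; now apply exp_increasing | lra]. }
    assert (Hl2 : lstep j ^ 2 <= 8 * tel j).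
    { pose proof (inv_sqr_le_tel j) as Hk. rewrite <- pow_inv in Hk.
      assert (lstep j ^ 2 <= (2 * / (INR j + 1)) ^ 2) by (apply pow_incr; lra). nra. }
    rewrite Rpow_mult_distr.
    pose proof (exp_pos (Cmod s * lstep j)). pose proof (exp_pos (2 * Cmod s)).
    assert (0 <= Cmod s ^ 2) by nra.
    assert (Cmod s ^ 2 * lstep j ^ 2 <= Cmod s ^ 2 * (8 * tel j)) by nra.
    apply Rle_trans with (3 * exp (2 * Cmod s) * (Cmod s ^ 2 * (8 * tel j))); [| right; ring].
    apply Rmult_le_compat; nra. }
  assert (Hquot : Cmod (pole z j) / Cmod (pole (z + s) j) <= Cmod z + 1).
  { apply Rle_div_l; [lra|].
    assert (Cmod (pole z j) <= Cmod z + (INR j + 1)).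
    { unfold pole. eapply Rle_trans; [apply Cmod_triangle|].
      rewrite Cmod_R, (Rabs_right (INR j + 1)); lra. }
    assert ((Cmod z + 1) * (INR j + 1) <= (Cmod z + 1) * Cmod (pole (z + s) j)).
    { apply Rmult_le_compat_l; lra. }
    nra. }
  assert (Hquot0 : 0 <= Cmod (pole z j) / Cmod (pole (z + s) j)).
  { apply Rdiv_le_0_compat; [apply Cmod_ge_0 | lra]. }
  assert (Hsq : Cmod s / Cmod (pole (z + s) j) <= Cmod s).
  { apply Rle_div_l; [lra | nra]. }
  assert (Hsq0 : 0 <= Cmod s / Cmod (pole (z + s) j)).
  { apply Rdiv_le_0_compat; lra. }
  assert (A1 : Cmod (pole z j) / Cmod (pole (z + s) j) * Cmod r
    <= (Cmod z + 1) * (24 * exp (2 * Cmod s) * Cmod s ^ 2 * tel j)).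
  { apply Rmult_le_compat; auto using Cmod_ge_0. }
  assert (A2 : Cmod s * Cmod (glin z j) * (Cmod s / Cmod (pole (z + s) j))
    <= Cmod s * ((4 + 2 * Cmod z) * tel j) * Cmod s).
  { apply Rmult_le_compat; auto.
    - apply Rmult_le_pos; auto using Cmod_ge_0.
    - apply Rmult_le_compat_l; auto. }
  eapply Rle_trans; [apply Rplus_le_compat; [exact A1 | exact A2]|]. right; ring.
Qed.

Definition gfac_bound (z : C) (r : R) : R :=
  (Cmod z + 1) * (24 * exp (2 * r)) + (4 + 2 * Cmod z).

Lemma gfac_bound_pos z r : 0 < gfac_bound z r.
Proof.
  unfold gfac_bound. pose proof (Cmod_ge_0 z). pose proof (exp_pos (2 * r)). nra.
Qed.

Lemma gfac_sub1_le z s j : 0 <= Re z -> 0 <= Re (z + s)%C ->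
  Cmod (gfac z s j - 1)%C
  <= (gfac_bound z (Cmod s) * (Cmod s + 1) * Cmod s) * tel j.
Proof.
  intros Hz Hs. pose proof (gfac_quadratic z s j Hz Hs) as H.
  fold (gfac_bound z (Cmod s)) in H.
  replace (gfac z s j - 1)%C
    with ((gfac z s j - 1 - s * glin z j) + s * glin z j)%C by ring.
  eapply Rle_trans; [apply Cmod_triangle|]. rewrite Cmod_mult.
  pose proof (glin_Cmod_le z j Hz) as Hl. pose proof (Cmod_ge_0 s).
  assert (Cmod s * Cmod (glin z j) <= Cmod s * (gfac_bound z (Cmod s) * tel j)).
  { apply Rmult_le_compat_l; [assumption|]. eapply Rle_trans; [exact Hl|].
    apply Rmult_le_compat_r; [left; apply tel_pos|]. unfold gfac_bound.
    pose proof (Cmod_ge_0 z). pose proof (exp_pos (2 * Cmod s)). nra. }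
  nra.
Qed.

Lemma cprod_ext f g n : (forall k, f k = g k) -> cprod f n = cprod g n.
Proof. intros H. induction n as [|n IH]; simpl; [reflexivity | now rewrite IH, H]. Qed.

Lemma cprod_mult f g n :
  cprod (fun k => (f k * g k)%C) n = (cprod f n * cprod g n)%C.
Proof. induction n as [|n IH]; simpl; [ring | rewrite IH; ring]. Qed.

Lemma cprod_gfac_1x z s n :
  cprod (fun k => (RtoC 1 + (gfac z s k - 1))%C) n = cprod (gfac z s) n.
Proof. apply cprod_ext; intros k; ring. Qed.

Lemma ex_Clim_gfac z s : 0 <= Re z -> 0 <= Re (z + s)%C ->
  exists l, Clim (cprod (gfac z s)) l.
Proof.
  intros Hz Hs.
  destruct (ex_Clim_cprod (fun k => gfac z s k - 1)%C _
              (fun k => gfac_sub1_le z s k Hz Hs)) as [l Hl].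
  exists l. eapply Clim_ext; [| exact Hl]. intros n; apply cprod_gfac_1x.
Qed.

Lemma ex_Clim_glin z : 0 <= Re z -> exists l, Clim (csum (glin z)) l.
Proof.
  intros Hz. apply ex_Clim_csum with (4 + 2 * Cmod z). intros k; now apply glin_Cmod_le.
Qed.

(** The uniformity in [n] is what allows passing to the limit and thus computing the
    derivative of Gamma without differentiating a limit of functions. *)
Lemma gfac_prod_linear z : 0 <= Re z -> exists B, forall s n,
  0 <= Re (z + s)%C -> Cmod s <= 1 ->
  Cmod (cprod (gfac z s) n - 1 - s * csum (glin z) n)%C <= B * Cmod s ^ 2.
Proof.
  intros Hz. set (D := gfac_bound z 1). pose proof (gfac_bound_pos z 1) as HD. fold D in HD.
  (* D is the constant of all the factors with |s| <= 1; 2 D takes in |s| + 1 <= 2 *)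
  exists (exp (2 * D) * (2 * D) ^ 2 + D). intros s n Hs Hs1.
  pose proof (Cmod_ge_0 s) as Hs0.
  assert (HDs : gfac_bound z (Cmod s) <= D).
  { unfold D, gfac_bound. pose proof (Cmod_ge_0 z).
    assert (exp (2 * Cmod s) <= exp (2 * 1)).
    { assert (Hle : 2 * Cmod s <= 2 * 1) by lra.
      destruct Hle as [Hlt | ->]; [left; now apply exp_increasing | lra]. }
    nra. }
  pose proof (gfac_bound_pos z (Cmod s)) as HDs0.
  assert (Hx : forall k, Cmod (gfac z s k - 1)%C <= (2 * D * Cmod s) * tel k).
  { intros k. eapply Rle_trans; [now apply gfac_sub1_le|].
    apply Rmult_le_compat_r; [left; apply tel_pos|].
    apply Rmult_le_compat_r; [assumption|].
    rewrite (Rmult_comm 2). apply Rmult_le_compat; lra. }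
  pose proof (cprod_linear _ _ n Hx) as H1. cbv beta in H1; rewrite cprod_gfac_1x in H1.
  assert (H2 : Cmod (csum (fun k => gfac z s k - 1)%C n - s * csum (glin z) n)%C
               <= D * Cmod s ^ 2).
  { replace (csum (fun k => gfac z s k - 1)%C n - s * csum (glin z) n)%C
      with (csum (fun k => gfac z s k - 1 - s * glin z k)%C n).
    - eapply Rle_trans.
      { apply csum_Cmod_le with (g := fun k => D * Cmod s ^ 2 * tel k).
        intros k _. eapply Rle_trans; [now apply gfac_quadratic|].
        fold (gfac_bound z (Cmod s)).
        apply Rmult_le_compat_r; [left; apply tel_pos|].
        apply Rmult_le_compat_r; [nra | assumption]. }
      rewrite rsum_scal. pose proof (tel_sum_bounds n).
      assert (0 <= D * Cmod s ^ 2) by nra. nra.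
    - rewrite <- csum_scal. clear.
      induction n as [|n IH]; simpl; [ring | rewrite IH; ring]. }
  replace (cprod (gfac z s) n - 1 - s * csum (glin z) n)%C
    with ((cprod (gfac z s) n - 1 - csum (fun k => gfac z s k - 1)%C n)
          + (csum (fun k => gfac z s k - 1)%C n - s * csum (glin z) n))%C by ring.
  eapply Rle_trans; [apply Cmod_triangle|].
  assert (exp (2 * D * Cmod s) <= exp (2 * D)).
  { assert (Hle : 2 * D * Cmod s <= 2 * D) by nra.
    destruct Hle as [Hlt | ->]; [left; now apply exp_increasing | lra]. }
  assert (exp (2 * D * Cmod s) * (2 * D * Cmod s) ^ 2
          <= exp (2 * D) * (2 * D) ^ 2 * Cmod s ^ 2).
  { rewrite (Rpow_mult_distr (2 * D)), <- Rmult_assoc.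
    apply Rmult_le_compat_r; [nra|]. apply Rmult_le_compat_r; [nra | assumption]. }
  nra.
Qed.

Lemma rising_factor z n : rising z (S n) = (z * cprod (pole z) n)%C.
Proof.
  induction n as [|n IH]; [simpl; ring|].
  change (rising z (S (S n))) with (rising z (S n) * (z + RtoC (INR (S n))))%C.
  rewrite IH, S_INR. simpl. unfold pole. ring.
Qed.

Lemma cprod_neq0 f n : (forall k, f k <> RtoC 0) -> cprod f n <> RtoC 0.
Proof.
  intros H. induction n as [|n IH]; simpl.
  - intros E; injection E; lra.
  - now apply Cmult_neq_0.
Qed.

Lemma Cexp_lstep_prod s n :
  cprod (fun j => Cexp (s * RtoC (lstep j))) n = Cexp (s * RtoC (ln (INR n))).
Proof.
  induction n as [|n IH]; simpl cprod.
  - simpl. rewrite ln_0, Cmult_0_r. now rewrite Cexp_0.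
  - rewrite IH, <- Cexp_plus. f_equal. unfold lstep. rewrite RtoC_minus. ring.
Qed.

Lemma gauss_prod_shift z s n : 0 < Re z -> 0 < Re (z + s)%C ->
  gauss_prod (z + s) n
  = (gauss_prod z n * (z / (z + s)) * cprod (gfac z s) n)%C.
Proof.
  intros Hz Hs.
  assert (Nz : z <> RtoC 0) by (intros ->; simpl in Hz; lra).
  assert (Ns : (z + s)%C <> RtoC 0) by (intros E; rewrite E in Hs; simpl in Hs; lra).
  assert (Np : cprod (pole z) n <> RtoC 0).
  { apply cprod_neq0; intros k; apply pole_neq0; lra. }
  assert (Nq : cprod (pole (z + s)) n <> RtoC 0).
  { apply cprod_neq0; intros k; apply pole_neq0; lra. }
  assert (E : (cprod (gfac z s) n * cprod (pole (z + s)) n)%C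
              = (cprod (pole z) n * Cexp (s * RtoC (ln (INR n))))%C).
  { rewrite <- Cexp_lstep_prod, <- !cprod_mult. apply cprod_ext. intros k.
    unfold gfac. field. apply pole_neq0; lra. }
  unfold gauss_prod. rewrite !rising_factor, Cmult_plus_distr_r, Cexp_plus.
  replace (Cexp (s * RtoC (ln (INR n))))
    with (cprod (gfac z s) n * cprod (pole (z + s)) n / cprod (pole z) n)%C
    by (rewrite E; field; assumption).
  field. repeat split; assumption.
Qed.

(** The translation formula based at [0], where the factor [1 / z] has to be
    removed. *)
Lemma gauss_prod_gfac z n : 0 < Re z -> (z * gauss_prod z n)%C = cprod (gfac (RtoC 0) z) n.
Proof.
  intros Hz.
  assert (Nz : z <> RtoC 0) by (intros ->; simpl in Hz; lra).
  assert (Nq : cprod (pole z) n <> RtoC 0).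
  { apply cprod_neq0; intros k; apply pole_neq0; lra. }
  assert (Ef : RtoC (INR (fact n)) = cprod (pole (RtoC 0)) n).
  { induction n as [|n IH]; [reflexivity|].
    change (fact (S n)) with (S n * fact n)%nat. rewrite mult_INR, RtoC_mult, IH.
    - simpl cprod. unfold pole at 3. rewrite S_INR. ring.
    - apply cprod_neq0; intros k; apply pole_neq0; lra. }
  unfold gauss_prod. rewrite rising_factor, Ef, <- Cexp_lstep_prod.
  assert (E : (cprod (gfac (RtoC 0) z) n * cprod (pole z) n)%C
     = (cprod (pole (RtoC 0)) n * cprod (fun j => Cexp (z * RtoC (lstep j))) n)%C).
  { rewrite <- !cprod_mult. apply cprod_ext. intros k.
    unfold gfac. rewrite Cplus_0_l. field. apply pole_neq0; lra. }
  rewrite <- E. field. split; assumption.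
Qed.

Lemma Clim_gauss_prod z : 0 < Re z -> Clim (gauss_prod z) (CGamma z).
Proof.
  intros Hz. apply (Climit_correct (gauss_prod z)).
  assert (Hz' : 0 <= Re (RtoC 0 + z)%C) by (rewrite Cplus_0_l; lra).
  destruct (ex_Clim_gfac (RtoC 0) z (Rle_refl 0) Hz') as [l Hl].
  exists (/ z * l)%C.
  apply Clim_ext with (fun n => (/ z * cprod (gfac (RtoC 0) z) n)%C).
  - intros n. rewrite <- gauss_prod_gfac by assumption. field.
    intros ->; simpl in Hz; lra.
  - apply Clim_mult; [apply Clim_const | exact Hl].
Qed.

(** The product based at [0] with increment [z], and the product based at [z] with
    increment [- z], are inverse to each other factor by factor and both converge. *)
Lemma CGamma_neq0 z : 0 < Re z -> CGamma z <> RtoC 0.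
Proof.
  intros Hz E.
  assert (Hz' : 0 <= Re (z + - z)%C) by (rewrite Cplus_opp_r; simpl; lra).
  destruct (ex_Clim_gfac z (- z)%C (Rlt_le _ _ Hz) Hz') as [l Hl].
  assert (H : Clim (fun n => (z * gauss_prod z n) * cprod (gfac z (- z)) n)%C
                (z * CGamma z * l)%C).
  { apply Clim_mult; [apply Clim_mult; [apply Clim_const | now apply Clim_gauss_prod]|].
    exact Hl. }
  assert (H1 : Clim (fun n => (z * gauss_prod z n) * cprod (gfac z (- z)) n)%C (RtoC 1)).
  { apply Clim_ext with (fun _ => RtoC 1); [| apply Clim_const].
    intros n. rewrite gauss_prod_gfac, <- cprod_mult by assumption.
    induction n as [|n IH]; [reflexivity|]. simpl. rewrite <- IH. unfold gfac.
    rewrite Cplus_0_l. replace (z + - z)%C with (RtoC 0) by ring.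
    replace (- z * RtoC (lstep n))%C with (- (z * RtoC (lstep n)))%C by ring.
    set (u := (z * RtoC (lstep n))%C).
    assert (Eu : Cexp (- u) = (/ Cexp u)%C).
    { pose proof (Cexp_neq0 u).
      transitivity (Cexp (- u) * Cexp u / Cexp u)%C; [field; assumption|].
      rewrite <- Cexp_plus. replace (- u + u)%C with (RtoC 0) by ring.
      rewrite Cexp_0. field; assumption. }
    rewrite Eu. field. repeat split; [apply Cexp_neq0 | |]; apply pole_neq0; simpl; lra. }
  pose proof (Clim_unique _ _ _ H H1) as F.
  rewrite E, Cmult_0_r, Cmult_0_l in F. injection F; lra.
Qed.

(** * The logarithmic derivative of the archimedean factor *)

(** [f] has logarithmic derivative [a] at [z], with a quadratic remainder.  In this
    relative form the logarithmic derivatives of a product add up. *)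
Definition log_tangent (f : C -> C) (z a : C) : Prop :=
  exists B r, 0 < r /\ forall s, Cmod s < r ->
    exists u, f (z + s)%C = (f z * u)%C /\ Cmod (u - 1 - a * s)%C <= B * Cmod s ^ 2.

Lemma log_tangent_mult f g z a b :
  log_tangent f z a -> log_tangent g z b ->
  log_tangent (fun x => (f x * g x)%C) z (a + b)%C.
Proof.
  intros [B [r [Hr H]]] [B' [r' [Hr' H']]].
  set (M := 1 + Cmod b + Rabs B').
  exists (Rabs B * M + (1 + Cmod a) * Rabs B' + Cmod a * Cmod b).
  exists (Rmin 1 (Rmin r r')). split.
  { repeat apply Rmin_glb_lt; lra. }
  intros s Hs.
  assert (Hs1 : Cmod s < 1) by (eapply Rlt_le_trans; [exact Hs | apply Rmin_l]).
  assert (Hs2 : Cmod s < Rmin r r') by (eapply Rlt_le_trans; [exact Hs | apply Rmin_r]).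
  destruct (H s) as [u [Eu Hu]].
  { eapply Rlt_le_trans; [exact Hs2 | apply Rmin_l]. }
  destruct (H' s) as [v [Ev Hv]].
  { eapply Rlt_le_trans; [exact Hs2 | apply Rmin_r]. }
  exists (u * v)%C. split; [rewrite Eu, Ev; ring|].
  pose proof (Cmod_ge_0 s) as Hs0. pose proof (Rle_abs B). pose proof (Rle_abs B').
  pose proof (Rabs_pos B). pose proof (Rabs_pos B').
  pose proof (Cmod_ge_0 a). pose proof (Cmod_ge_0 b).
  assert (Hq : 0 <= Cmod s ^ 2 <= 1) by nra.
  assert (Hu' : Cmod (u - 1 - a * s)%C <= Rabs B * Cmod s ^ 2) by nra.
  assert (Hv' : Cmod (v - 1 - b * s)%C <= Rabs B' * Cmod s ^ 2) by nra.
  assert (HvM : Cmod v <= M).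
  { replace v with (1 + b * s + (v - 1 - b * s))%C by ring.
    eapply Rle_trans; [apply Cmod_triangle|].
    pose proof (Cmod_triangle 1 (b * s)) as T. rewrite Cmod_1, Cmod_mult in T.
    unfold M. nra. }
  assert (Hab : Cmod (1 + a * s)%C <= 1 + Cmod a).
  { eapply Rle_trans; [apply Cmod_triangle|]. rewrite Cmod_1, Cmod_mult. nra. }
  replace (u * v - 1 - (a + b) * s)%C
    with ((u - 1 - a * s) * v + (1 + a * s) * (v - 1 - b * s) + a * s * (b * s))%C by ring.
  eapply Rle_trans; [apply Cmod_triangle|].
  eapply Rle_trans; [apply Rplus_le_compat_r, Cmod_triangle|].
  rewrite !Cmod_mult.
  assert (Cmod (u - 1 - a * s)%C * Cmod v <= Rabs B * Cmod s ^ 2 * M).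
  { apply Rmult_le_compat; auto using Cmod_ge_0. }
  assert (Cmod (1 + a * s)%C * Cmod (v - 1 - b * s)%C
          <= (1 + Cmod a) * (Rabs B' * Cmod s ^ 2)).
  { apply Rmult_le_compat; auto using Cmod_ge_0. }
  nra.
Qed.

Lemma log_tangent_scale f c z a :
  log_tangent f (z * c)%C a -> log_tangent (fun x => f (x * c)%C) z (a * c)%C.
Proof.
  intros [B [r [Hr H]]]. pose proof (Cmod_ge_0 c).
  exists (B * Cmod c ^ 2), (r / (Cmod c + 1)). split; [apply Rdiv_lt_0_compat; lra|].
  intros s Hs. apply Rlt_div_r in Hs; [| lra].
  destruct (H (s * c)%C) as [u [Eu Hu]].
  { rewrite Cmod_mult. pose proof (Cmod_ge_0 s). nra. }
  exists u. split; [rewrite <- Eu; f_equal; ring|].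
  rewrite Cmod_mult, Rpow_mult_distr in Hu.
  replace (a * c * s)%C with (a * (s * c))%C by ring. lra.
Qed.

Lemma log_tangent_Cexp z : log_tangent Cexp z 1.
Proof.
  exists (3 * exp 1), 1. split; [lra|]. intros s Hs.
  exists (Cexp s). split; [apply Cexp_plus|].
  rewrite Cmult_1_l. eapply Rle_trans; [apply Cexp_quadratic|].
  assert (exp (Cmod s) <= exp 1) by (left; now apply exp_increasing).
  apply Rmult_le_compat_r; [apply pow2_ge_0 | lra].
Qed.

(** By translation, [CGamma (z + s) / CGamma z] is [z / (z + s)] times a limit of
    products of [gfac], whose expansion in [s] is known uniformly. *)
Lemma log_tangent_CGamma z : 0 < Re z -> exists L,
  Clim (fun n => RtoC (ln (INR n)) - csum (fun k => / (z + RtoC (INR k))) (S n))%C L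
  /\ log_tangent CGamma z L.
Proof.
  intros Hz. assert (Nz : z <> RtoC 0) by (intros ->; simpl in Hz; lra).
  destruct (ex_Clim_glin z) as [L HL]; [lra|].
  exists (L - / z)%C. split.
  - apply Clim_ext with (fun n => csum (glin z) n - / z)%C.
    2: { apply Clim_minus; [exact HL | apply Clim_const]. }
    intros n. rewrite csum_head. simpl (INR 0). rewrite Cplus_0_r.
    replace (csum (glin z) n)
      with (RtoC (ln (INR n)) - csum (fun k => / (z + RtoC (INR (S k)))) n)%C; [ring|].
    induction n as [|n IH].
    + simpl. rewrite ln_0. ring.
    + rewrite !csum_S, <- IH. unfold glin, lstep, pole.
      rewrite RtoC_minus, <- S_INR. ring.
  - destruct (gfac_prod_linear z) as [B HB]; [lra|].
    assert (Hz0 : 0 < Cmod z) by now apply Cmod_gt_0.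
    set (B1 := / Cmod z ^ 2 * 2).
    assert (Hlt : log_tangent (fun x => / x)%C z (- / z)%C).
    { exists B1, (Cmod z / 2). split; [lra|]. intros s Hs.
      assert (Hzs : Cmod z / 2 <= Cmod (z + s)%C).
      { pose proof (Cmod_minus_le (z + s) s) as T.
        replace (z + s - s)%C with z in T by ring. lra. }
      assert (Nzs : (z + s)%C <> RtoC 0) by (apply Cmod_gt_0; lra).
      exists (z / (z + s))%C. split; [field; now split|].
      replace (z / (z + s) - 1 - - / z * s)%C with (s * s / (z * (z + s)))%C
        by (field; now split).
      rewrite Cmod_div by now apply Cmult_neq_0. rewrite !Cmod_mult.
      apply Rle_div_l; [nra|]. unfold B1. pose proof (Cmod_ge_0 s).
      replace (/ Cmod z ^ 2 * 2 * Cmod s ^ 2 * (Cmod z * Cmod (z + s)%C))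
        with (2 * Cmod (z + s)%C / Cmod z * (Cmod s * Cmod s)) by (field; lra).
      assert (1 <= 2 * Cmod (z + s)%C / Cmod z) by (apply Rle_div_r; lra).
      nra. }
    (* z CGamma z expands like the product of gfac alone; dividing by z adds - 1 / z *)
    assert (Hg : log_tangent (fun x => x * CGamma x)%C z L).
    { exists B, (Rmin 1 (Re z)). split; [apply Rmin_glb_lt; lra|]. intros s Hs.
      assert (Hs1 : Cmod s < 1) by (eapply Rlt_le_trans; [exact Hs | apply Rmin_l]).
      assert (Hs2 : Cmod s < Re z) by (eapply Rlt_le_trans; [exact Hs | apply Rmin_r]).
      assert (Hzs : 0 < Re (z + s)%C).
      { pose proof (re_le_Cmod s) as Hr. pose proof (Rle_abs (- Re s)) as Hr'.
        rewrite Rabs_Ropp in Hr'. simpl. unfold Re in *. lra. }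
      assert (Nzs : (z + s)%C <> RtoC 0) by (intros E; rewrite E in Hzs; simpl in Hzs; lra).
      destruct (ex_Clim_gfac z s) as [u Hu]; [lra | lra |].
      exists u. split.
      - assert (E : CGamma (z + s) = (CGamma z * (z / (z + s)) * u)%C).
        { apply (Clim_unique (gauss_prod (z + s))); [now apply Clim_gauss_prod|].
          eapply Clim_ext; [intros n; symmetry; now apply gauss_prod_shift|].
          apply Clim_mult; [apply Clim_mult; [now apply Clim_gauss_prod | apply Clim_const]|].
          exact Hu. }
        rewrite E. field. assumption.
      - replace (L * s)%C with (s * L)%C by ring.
        apply Clim_Cmod_le with (fun n => cprod (gfac z s) n - 1 - s * csum (glin z) n)%C.
        + apply Clim_minus; [apply Clim_minus; [exact Hu | apply Clim_const]|].
          apply Clim_mult; [apply Clim_const | exact HL].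
        + intros n. apply HB; lra. }
    pose proof (log_tangent_mult _ _ _ _ _ Hg Hlt) as [B2 [r2 [Hr2 H2]]].
    exists B2, (Rmin r2 (Cmod z)). split; [apply Rmin_glb_lt; lra|]. intros s Hs.
    assert (Hs1 : Cmod s < r2) by (eapply Rlt_le_trans; [exact Hs | apply Rmin_l]).
    assert (Hs2 : Cmod s < Cmod z) by (eapply Rlt_le_trans; [exact Hs | apply Rmin_r]).
    assert (Nzs : (z + s)%C <> RtoC 0).
    { intros E. replace z with ((z + s) - s)%C in Hs2 by ring.
      rewrite E in Hs2. replace (0 - s)%C with (- s)%C in Hs2 by ring.
      rewrite Cmod_opp in Hs2. lra. }
    destruct (H2 s Hs1) as [u [Eu Hu]]. exists u. split; [| exact Hu].
    replace (CGamma (z + s)) with ((z + s) * CGamma (z + s) * / (z + s))%C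
      by (field; assumption).
    rewrite Eu. field. assumption.
Qed.

(** [C_derive] is the limit of difference quotients along a horizontal line, so
    the remainder is estimated at real increments. *)
Lemma C_derive_log_tangent f z a :
  log_tangent f z a -> C_derive f z = (f z * a)%C.
Proof.
  intros [B [r [Hr H]]].
  assert (Hlim : forall g : C -> R, (forall c, Rabs (g c) <= Cmod c) ->
     (forall c d, g (c - d)%C = g c - g d) ->
     is_lim (fun x : R => g ((f (x, snd z) - f z) / ((x, snd z) - z))%C) (fst z)
            (g (f z * a)%C)).
  { intros g Hg Hgm. apply is_lim_spec. intros eps. simpl.
    set (K := Cmod (f z) * Rabs B + 1).
    assert (HK : 0 < K).
    { unfold K. pose proof (Cmod_ge_0 (f z)). pose proof (Rabs_pos B). nra. }
    assert (Hd : 0 < Rmin r (eps / K)).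
    { apply Rmin_glb_lt; [exact Hr | apply Rdiv_lt_0_compat; [apply eps | exact HK]]. }
    enough (Hx0 : forall x : R, Rabs (x - fst z) < Rmin r (eps / K) -> x <> fst z ->
      Rabs (g ((f (x, snd z) - f z) / ((x, snd z) - z))%C - g (f z * a)%C) < eps)
      by (exists (mkposreal _ Hd); intros x Hx Hxz; exact (Hx0 x Hx Hxz)).
    intros x Hx Hxz.
    set (s := RtoC (x - fst z)).
    assert (Es : (x, snd z) = (z + s)%C).
    { apply injective_projections.
      - exact (eq_sym (Rplus_minus (fst z) x)).
      - exact (eq_sym (Rplus_0_r (snd z))). }
    assert (Ns : s <> RtoC 0) by (unfold s; intros E; injection E; lra).
    assert (Hs : Cmod s < r /\ Cmod s < eps / K).
    { unfold s; rewrite Cmod_R. split; eapply Rlt_le_trans; try exact Hx;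
        [apply Rmin_l | apply Rmin_r]. }
    destruct Hs as [Hs1 Hs2]. destruct (H s Hs1) as [u [Eu Hu]].
    rewrite Es, Eu, <- Hgm. replace (z + s - z)%C with s by ring. eapply Rle_lt_trans; [apply Hg|].
    replace ((f z * u - f z) / s - f z * a)%C
      with (f z * ((u - 1 - a * s) / s))%C
      by (field; assumption).
    rewrite Cmod_mult, Cmod_div by assumption.
    assert (Hs0 : 0 < Cmod s) by now apply Cmod_gt_0.
    assert (Hq : Cmod (u - 1 - a * s)%C / Cmod s <= Rabs B * Cmod s).
    { apply Rle_div_l; [exact Hs0|]. pose proof (Rle_abs B).
      assert (0 <= Cmod s ^ 2) by nra. nra. }
    apply Rle_lt_trans with (Cmod (f z) * (Rabs B * Cmod s)).
    { apply Rmult_le_compat_l; [apply Cmod_ge_0 | exact Hq]. }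
    apply Rlt_div_r in Hs2; [| exact HK]. unfold K in Hs2. nra. }
  apply injective_projections.
  - exact (f_equal real (is_lim_unique _ _ _ (Hlim fst re_le_Cmod (fun c d => eq_refl)))).
  - exact (f_equal real (is_lim_unique _ _ _ (Hlim snd Im_le_Cmod (fun c d => eq_refl)))).
Qed.

(** The digamma limit at [w / 2], halved, together with the derivative of
    [- (s / 2) log pi]. *)
Lemma Clogderiv_GammaR w : 0 < Re w ->
  Clim (fun n => RtoC ((ln (INR n) - ln PI) / 2)
                 - csum (fun k => / (w + RtoC (2 * INR k))) (S n))%C
       (Clogderiv GammaR w).
Proof.
  intros Hw.
  assert (Hw2 : 0 < Re (w * RtoC (/ 2))%C) by (unfold Re in *; simpl; lra).
  destruct (log_tangent_CGamma _ Hw2) as [L [HL Ht]].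
  assert (HT : log_tangent
     (fun x => Cexp (x * RtoC (- ln PI / 2)) * CGamma (x * RtoC (/ 2)))%C w
     (1 * RtoC (- ln PI / 2) + L * RtoC (/ 2))%C).
  { apply log_tangent_mult; apply (log_tangent_scale _ _ w); [apply log_tangent_Cexp | exact Ht]. }
  assert (Eh : forall x, (x / RtoC 2)%C = (x * RtoC (/ 2))%C).
  { intros x. unfold Cdiv. now rewrite RtoC_inv by lra. }
  assert (EG : forall x, GammaR x
     = (Cexp (x * RtoC (- ln PI / 2)) * CGamma (x * RtoC (/ 2)))%C).
  { intros x. unfold GammaR. rewrite !Eh. f_equal. f_equal.
    apply injective_projections; simpl; field. }
  assert (HT' : log_tangent GammaR w (1 * RtoC (- ln PI / 2) + L * RtoC (/ 2))%C).
  { destruct HT as [B [r [Hr H]]]. exists B, r. split; [exact Hr|]. intros s Hs.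
    rewrite !EG. exact (H s Hs). }
  unfold Clogderiv. rewrite (C_derive_log_tangent _ _ _ HT').
  assert (NG : GammaR w <> RtoC 0).
  { rewrite EG. apply Cmult_neq_0; [apply Cexp_neq0 | now apply CGamma_neq0]. }
  replace (GammaR w * (1 * RtoC (- ln PI / 2) + L * RtoC (/ 2)) / GammaR w)%C
    with (RtoC (- ln PI / 2) + L * RtoC (/ 2))%C by (field; assumption).
  eapply Clim_ext;
    [| apply Clim_plus; [apply Clim_const | apply Clim_mult; [exact HL | apply Clim_const]]].
  intros n; cbv beta.
  replace (csum (fun k => / (w * RtoC (/ 2) + RtoC (INR k))) (S n))%C
    with (RtoC 2 * csum (fun k => / (w + RtoC (2 * INR k))) (S n))%C.
  - assert (E2 : RtoC (/ 2) = (/ RtoC 2)%C) by (apply RtoC_inv; lra).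
    rewrite E2. unfold Rdiv. rewrite !RtoC_mult, !RtoC_minus, RtoC_opp, E2. field.
  - rewrite <- csum_scal. apply csum_ext. intros k _.
    assert (N : forall c : C, 0 < Re c -> c <> RtoC 0) by (intros c Hc ->; simpl in Hc; lra).
    pose proof (pos_INR k).
    rewrite RtoC_inv by lra. rewrite RtoC_mult.
    field. apply N; unfold Re in *; simpl; lra.
Qed.

(** * Uniqueness of power series expansions *)

Lemma sum_n_csum (u : nat -> C) n : sum_n (u : nat -> C_AbelianMonoid) n = csum u (S n).
Proof.
  induction n as [|n IH].
  - rewrite sum_O. simpl. ring.
  - rewrite sum_Sn, IH. reflexivity.
Qed.

Lemma is_series_Clim (u : nat -> C) (l : C) :
  @is_series C_AbsRing C_NormedModule u l <-> Clim (fun n => csum u (S n)) l.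
Proof.
  unfold is_series.
  apply (iff_trans (@filterlim_locally _ C_NormedModule eventually _
                      (sum_n (u : nat -> C_NormedModule)) l)).
  split.
  - intros H; split; apply is_lim_seq_spec; intros eps;
      generalize (H eps); apply filter_imp; intros n Hn;
      change (@ball C_UniformSpace l eps (sum_n (u : nat -> C_AbelianMonoid) n)) in Hn;
      rewrite sum_n_csum in Hn; destruct Hn as [H1 H2]; [exact H1 | exact H2].
  - intros [H1 H2] eps. apply is_lim_seq_spec in H1. apply is_lim_seq_spec in H2.
    generalize (filter_and _ _ (H1 eps) (H2 eps)). apply filter_imp.
    intros n [A B].
    change (@ball C_UniformSpace l eps (sum_n (u : nat -> C_AbelianMonoid) n)). rewrite sum_n_csum.
    split; [exact A | exact B].
Qed.

Lemma is_pseries_Clim (a : nat -> C) (s l : C) :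
  @is_pseries C_AbsRing C_NormedModule a s l
  <-> Clim (fun n => csum (fun k => (s ^ k * a k)%C) (S n)) l.
Proof.
  unfold is_pseries. rewrite is_series_Clim.
  split; apply Clim_ext; intros n; apply csum_ext; intros k _;
    reflexivity.
Qed.

Lemma sum_n_part (g : C -> R) (u : nat -> C) n :
  g (RtoC 0) = 0 -> (forall a b, g (a + b)%C = g a + g b) ->
  sum_n (fun k => g (u k)) n = g (csum u (S n)).
Proof.
  intros H0 H. induction n as [|n IH].
  - rewrite sum_O. simpl. rewrite H, H0. ring.
  - rewrite sum_Sn, IH. rewrite (csum_S u (S n)), H. reflexivity.
Qed.

(** Outside the disc of convergence the terms do not tend to [0]. *)
Lemma CV_radius_gt_0 (a : nat -> R) (x : R) :
  0 < x -> ex_pseries a x -> Rbar_lt 0 (CV_radius a).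
Proof.
  intros Hx He. apply Rbar_lt_le_trans with x; [exact Hx|].
  apply Rbar_not_lt_le. intros Hlt.
  apply (CV_disk_outside a x).
  - rewrite Rabs_right by lra. exact Hlt.
  - apply ex_series_lim_0. eapply ex_series_ext; [| exact He].
    intros n. simpl. rewrite pow_n_pow. apply Rmult_comm.
Qed.

(** Restricting to real arguments and taking a real-linear functional [g] (the real
    or the imaginary part) reduces uniqueness to real power series. *)
Lemma expands_at_0_part_unique (g : C -> R) (f : C -> C) (a b : nat -> C) :
  (forall u l, Clim u l -> is_lim_seq (fun n => g (u n)) (g l)) ->
  g (RtoC 0) = 0 -> (forall x y, g (x + y)%C = g x + g y) ->
  (forall (c : R) x, g (RtoC c * x)%C = c * g x) ->
  expands_at_0 f a -> expands_at_0 f b -> forall n, g (a n) = g (b n).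
Proof.
  intros Hlim H0 Hadd Hscal [r [Hr Ha]] [r' [Hr' Hb]] n.
  assert (Hp : forall (c : nat -> C) (x : R),
     @is_pseries C_AbsRing C_NormedModule c (RtoC x) (f (RtoC x)) ->
     is_pseries (fun k => g (c k)) x (g (f (RtoC x)))).
  { intros c x H. apply is_pseries_Clim, Hlim in H.
    unfold is_pseries, is_series.
    apply (is_lim_seq_ext _ _ _ (fun m => eq_sym (sum_n_part g _ m H0 Hadd))) in H.
    revert H. apply is_lim_seq_ext. intros m. apply sum_n_ext. intros k.
    rewrite <- RtoC_pow, Hscal. reflexivity. }
  set (d := Rmin r r'). assert (Hd : 0 < d) by (apply Rmin_glb_lt; assumption).
  assert (Hda : forall x, Rabs x < d -> is_pseries (fun k => g (a k)) x (g (f (RtoC x)))).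
  { intros x Hx. apply Hp, Ha. rewrite Cmod_R.
    eapply Rlt_le_trans; [exact Hx | apply Rmin_l]. }
  assert (Hdb : forall x, Rabs x < d -> is_pseries (fun k => g (b k)) x (g (f (RtoC x)))).
  { intros x Hx. apply Hp, Hb. rewrite Cmod_R.
    eapply Rlt_le_trans; [exact Hx | apply Rmin_r]. }
  assert (Hhalf : Rabs (d / 2) < d) by (rewrite Rabs_right; lra).
  apply (PSeries_ext_recip (fun k => g (a k)) (fun k => g (b k)) n).
  - apply CV_radius_gt_0 with (d / 2); [lra|]. eexists; apply Hda, Hhalf.
  - apply CV_radius_gt_0 with (d / 2); [lra|]. eexists; apply Hdb, Hhalf.
  - exists (mkposreal d Hd). intros x Hx.
    change (Rabs (x - 0) < d) in Hx. rewrite Rminus_0_r in Hx.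
    now rewrite (is_pseries_unique _ _ _ (Hda x Hx)), (is_pseries_unique _ _ _ (Hdb x Hx)).
Qed.

Lemma expands_at_0_unique f a b :
  expands_at_0 f a -> expands_at_0 f b -> forall n, a n = b n.
Proof.
  intros Ha Hb n. apply injective_projections.
  - apply (expands_at_0_part_unique Re f); auto.
    + intros u l [H _]; exact H.
    + intros c x; unfold Re, Im; simpl; ring.
  - apply (expands_at_0_part_unique Im f); auto.
    + intros u l [_ H]; exact H.
    + intros c x; unfold Re, Im; simpl; ring.
Qed.

(** * The coefficients tau *)

(** [- 1 / w_k]: the signs of the geometric expansion and of the binomial sum are
    absorbed here, since [1 + vpole kappa k = 1 - 1 / w_k]. *)
Definition vpole (kappa : C) (k : nat) : C :=
  (- / (RtoC 1 + kappa + RtoC (2 * INR k)))%C.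

Lemma Cmod_shift_ge kappa k : - (1 / 2) < Re kappa ->
  (INR k + 1) / 2 <= Cmod (RtoC 1 + kappa + RtoC (2 * INR k))%C.
Proof.
  intros H. eapply Rle_trans; [| apply re_le_Cmod].
  eapply Rle_trans; [| apply Rle_abs]. pose proof (pos_INR k).
  unfold Re in *; simpl; lra.
Qed.

Lemma vpole_Cmod_le kappa k : - (1 / 2) < Re kappa ->
  Cmod (vpole kappa k) <= 2 * / (INR k + 1).
Proof.
  intros H. pose proof (Cmod_shift_ge kappa k H) as Hw. pose proof (pos_INR k).
  unfold vpole. rewrite Cmod_opp, Cmod_inv by (apply Cmod_gt_0; lra).
  replace (2 * / (INR k + 1)) with (/ ((INR k + 1) / 2)) by (field; lra).
  apply Rinv_le_contravar; lra.
Qed.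

Lemma vpole_Cmod_le_2 kappa k : - (1 / 2) < Re kappa -> Cmod (vpole kappa k) <= 2.
Proof.
  intros H. eapply Rle_trans; [now apply vpole_Cmod_le|]. pose proof (pos_INR k).
  assert (/ (INR k + 1) <= 1) by (rewrite <- Rinv_1; apply Rinv_le_contravar; lra).
  lra.
Qed.

Lemma vpole_Cmod_sqr_le kappa k : - (1 / 2) < Re kappa ->
  Cmod (vpole kappa k) ^ 2 <= 8 * tel k.
Proof.
  intros H. pose proof (inv_sqr_le_tel k) as Ht. rewrite <- pow_inv in Ht.
  pose proof (pow_incr _ _ 2 (conj (Cmod_ge_0 _) (vpole_Cmod_le kappa k H))). nra.
Qed.

(** The part of the coefficient [tau_j] due to [kappa], truncated at [M]. *)
Definition coef_approx (kappa : C) (j M : nat) : C :=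
  ((match j with O => RtoC ((ln (INR M) - ln PI) / 2) | S _ => RtoC 0 end)
   + csum (fun k => vpole kappa k ^ S j) (S M))%C.

Lemma Clim_incr u l : Clim u l -> Clim (fun n => u (S n)) l.
Proof.
  intros [H1 H2]. apply is_lim_seq_incr_1 in H1. apply is_lim_seq_incr_1 in H2.
  now split.
Qed.

(** [- 1 / (w_k + s) = v / (1 - s v)] for [v = vpole kappa k]. *)
Lemma Clim_logderiv_shift kappa s : - (1 / 2) < Re kappa -> Cmod s < 1 / 4 ->
  Clim (fun M => RtoC ((ln (INR M) - ln PI) / 2)
                 + csum (fun k => vpole kappa k / (1 - s * vpole kappa k)) (S M))%C
       (Clogderiv GammaR (s + RtoC 1 + kappa)).
Proof.
  intros Hk Hs.
  assert (Hre : 0 < Re (s + RtoC 1 + kappa)%C).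
  { pose proof (re_le_Cmod s) as Hr. pose proof (Rle_abs (- Re s)) as Hr'.
    rewrite Rabs_Ropp in Hr'. unfold Re in *; simpl; lra. }
  eapply Clim_ext; [| apply Clogderiv_GammaR; exact Hre].
  intros M. unfold Cminus at 1. f_equal.
  replace (- csum (fun k => / (s + RtoC 1 + kappa + RtoC (2 * INR k))) (S M))%C
    with (RtoC (-1) * csum (fun k => / (s + RtoC 1 + kappa + RtoC (2 * INR k))) (S M))%C
    by (apply injective_projections; simpl; ring).
  rewrite <- csum_scal. apply csum_ext. intros k _.
  pose proof (pos_INR k).
  assert (N1 : (RtoC 1 + kappa + RtoC (2 * INR k))%C <> RtoC 0).
  { apply Cmod_gt_0. pose proof (Cmod_shift_ge kappa k Hk). lra. }
  assert (N2 : (s + RtoC 1 + kappa + RtoC (2 * INR k))%C <> RtoC 0).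
  { intros E. apply (f_equal Re) in E. unfold Re in *; simpl in *. lra. }
  unfold vpole. set (c := RtoC (2 * INR k)) in *.
  replace (RtoC (-1)) with (- RtoC 1)%C by (apply injective_projections; simpl; ring).
  field. split; [assumption|].
  replace (_ - _)%C with (s + 1 + kappa + c)%C by ring. assumption.
Qed.

(** For [j = 0] the sum diverges logarithmically and only its combination with
    [ln M] converges; this is the digamma limit at [s = 0].  For [j >= 1] the
    convergence is absolute. *)
Lemma ex_Clim_coef kappa j : - (1 / 2) < Re kappa ->
  exists l, Clim (coef_approx kappa j) l.
Proof.
  intros H. destruct j as [|j].
  - eexists. eapply Clim_ext; [| apply (Clim_logderiv_shift kappa (RtoC 0) H)].
    + intros M. unfold coef_approx. f_equal. apply csum_ext. intros k _.
      simpl Cpow. field.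
    + rewrite Cmod_0; lra.
  - destruct (ex_Clim_csum (fun k => vpole kappa k ^ S (S j))%C (2 ^ j * 8)) as [l Hl].
    + intros k. rewrite Cmod_pow. simpl.
      pose proof (vpole_Cmod_sqr_le kappa k H) as H2. pose proof (vpole_Cmod_le_2 kappa k H).
      pose proof (Cmod_ge_0 (vpole kappa k)).
      pose proof (pow_incr _ _ j (conj H1 H0)). pose proof (pow_le _ j H1).
      pose proof (tel_pos k). simpl in H2. nra.
    + exists l. eapply Clim_ext; [| apply Clim_incr, Hl].
      intros M. unfold coef_approx. ring.
Qed.

Definition coef (kappa : C) (j : nat) : C := Climit (coef_approx kappa j).

Lemma Clim_coef kappa j : - (1 / 2) < Re kappa -> Clim (coef_approx kappa j) (coef kappa j).
Proof. intros H. now apply Climit_correct, ex_Clim_coef. Qed.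

Lemma geometric_sum (v s : C) (J : nat) : (1 - s * v)%C <> RtoC 0 ->
  csum (fun j => s ^ j * v ^ S j)%C J = (v * (1 - (s * v) ^ J) / (1 - s * v))%C.
Proof.
  intros N. induction J as [|J IH].
  - simpl. field. exact N.
  - rewrite csum_S, IH, !Cpow_S, Cpow_mult_l. field. exact N.
Qed.

Lemma coef_partial_sum kappa s M J :
  (forall k, (1 - s * vpole kappa k)%C <> RtoC 0) ->
  csum (fun j => s ^ j * coef_approx kappa j M)%C (S J)
  = (RtoC ((ln (INR M) - ln PI) / 2)
     + csum (fun k => vpole kappa k / (1 - s * vpole kappa k)) (S M)
     - csum (fun k => vpole kappa k * (s * vpole kappa k) ^ S J
                      / (1 - s * vpole kappa k)) (S M))%C.
Proof.
  intros N.
  transitivity (RtoC ((ln (INR M) - ln PI) / 2)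
      + csum (fun j => csum (fun k => s ^ j * vpole kappa k ^ S j) (S M)) (S J))%C.
  - rewrite !(csum_head _ J). unfold coef_approx at 1.
    rewrite (csum_ext _ (fun j => csum (fun k => s ^ S j * vpole kappa k ^ S (S j)) (S M))%C J).
    + rewrite csum_scal. simpl Cpow. ring.
    + intros j _. rewrite csum_scal. unfold coef_approx. ring.
  - rewrite csum_exchange. unfold Cminus. rewrite <- Cplus_assoc. f_equal.
    replace (- csum (fun k => vpole kappa k * (s * vpole kappa k) ^ S J
                      / (1 + - (s * vpole kappa k))) (S M))%C
      with (RtoC (-1) * csum (fun k => vpole kappa k * (s * vpole kappa k) ^ S J
                      / (1 + - (s * vpole kappa k))) (S M))%C
      by (apply injective_projections; simpl; ring).
    rewrite <- csum_scal, <- csum_plus. apply csum_ext. intros k _.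
    rewrite geometric_sum by apply N.
    replace (RtoC (-1)) with (- RtoC 1)%C by (apply injective_projections; simpl; ring).
    unfold Cminus. field. apply N.
Qed.

(** At each finite level [M] the remainder of the geometric expansion is
    [sum_k v_k (s v_k) ^ (J + 1) / (1 - s v_k)], bounded independently of [M].
    Passing to the limit in [M] replaces an exchange of two infinite sums. *)
Lemma coef_expansion kappa s J : - (1 / 2) < Re kappa -> Cmod s < 1 / 4 ->
  Cmod (Clogderiv GammaR (s + RtoC 1 + kappa)
        - csum (fun j => s ^ j * coef kappa j)%C (S J))%C <= 4 * (/ 2) ^ J.
Proof.
  intros Hk Hs.
  assert (Hsv : forall k, Cmod (s * vpole kappa k)%C <= / 2).
  { intros k. rewrite Cmod_mult. pose proof (vpole_Cmod_le_2 kappa k Hk).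
    pose proof (Cmod_ge_0 s). pose proof (Cmod_ge_0 (vpole kappa k)). nra. }
  assert (Hd : forall k, / 2 <= Cmod (1 - s * vpole kappa k)%C).
  { intros k. pose proof (Cmod_triangle (1 - s * vpole kappa k) (s * vpole kappa k)) as T.
    replace (1 - s * vpole kappa k + s * vpole kappa k)%C with (RtoC 1) in T by ring.
    rewrite Cmod_1 in T. specialize (Hsv k). lra. }
  assert (N : forall k, (1 - s * vpole kappa k)%C <> RtoC 0).
  { intros k. apply Cmod_gt_0. specialize (Hd k). lra. }
  apply Clim_Cmod_le with
    (fun M => csum (fun k => vpole kappa k * (s * vpole kappa k) ^ S J
                      / (1 - s * vpole kappa k)) (S M))%C.
  - apply Clim_ext with (fun M => RtoC ((ln (INR M) - ln PI) / 2)
                 + csum (fun k => vpole kappa k / (1 - s * vpole kappa k)) (S M)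
                 - csum (fun j => s ^ j * coef_approx kappa j M) (S J))%C.
    { intros M. rewrite coef_partial_sum by exact N. ring. }
    apply Clim_minus; [now apply Clim_logderiv_shift|].
    apply (Clim_csum (fun j M => s ^ j * coef_approx kappa j M)%C).
    intros j. apply Clim_mult; [apply Clim_const | now apply Clim_coef].
  - intros M. eapply Rle_trans.
    { apply csum_Cmod_le with (g := fun k => 4 * (/ 2) ^ J * tel k).
      intros k _. rewrite Cmod_div, Cmod_mult, Cmod_pow by apply N.
      specialize (Hsv k). specialize (Hd k).
      apply Rle_div_l; [lra|].
      pose proof (vpole_Cmod_sqr_le kappa k Hk) as H2.
      pose proof (Cmod_ge_0 (s * vpole kappa k)%C) as H0.
      pose proof (pow_incr _ _ J (conj H0 Hsv)) as Hp. pose proof (pow_le _ J H0) as Hp0.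
      pose proof (tel_pos k). pose proof (Cmod_ge_0 (vpole kappa k)).
      simpl pow. rewrite (Cmod_mult s (vpole kappa k)) at 1.
      set (v := Cmod (vpole kappa k)) in *. set (q := Cmod (s * vpole kappa k)%C) in *.
      set (d := Cmod (1 - s * vpole kappa k)%C) in *. simpl in H2.
      pose proof (Cmod_ge_0 s).
      assert (A1 : v * (Cmod s * v) <= 2 * tel k) by nra.
      assert (A2 : v * (Cmod s * v) * q ^ J <= 2 * tel k * (/ 2) ^ J).
      { apply Rmult_le_compat; try assumption.
        apply Rmult_le_pos; [assumption | now apply Rmult_le_pos]. }
      assert (0 <= tel k * (/ 2) ^ J) by (apply Rmult_le_pos; lra).
      nra. }
    rewrite rsum_scal. pose proof (tel_sum_bounds (S M)).
    assert (0 <= (/ 2) ^ J) by (apply pow_le; lra). nra.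
Qed.

Definition tau_coef {N : nat} (p : automorphic_data N) (j : nat) : C :=
  ((match j with O => RtoC (1 / 2 * ln (INR (conductor p))) | S _ => RtoC 0 end)
   + Csum (map (fun kappa => coef kappa j) (kappas p)))%C.

Lemma Csum_csum (f : C -> nat -> C) (l : list C) n :
  csum (fun j => Csum (map (fun x => f x j) l)) n = Csum (map (fun x => csum (f x) n) l).
Proof.
  induction l as [|x l IH]; simpl.
  - induction n as [|n IHn]; simpl; [reflexivity | rewrite IHn; ring].
  - now rewrite csum_plus, IH.
Qed.

Lemma Csum_scal c (f : C -> C) (l : list C) :
  Csum (map (fun x => c * f x)%C l) = (c * Csum (map f l))%C.
Proof. induction l as [|x l IH]; simpl; [ring | rewrite IH; ring]. Qed.

Lemma Csum_minus_le (f g : C -> C) (l : list C) (b : R) :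
  (forall x, In x l -> Cmod (f x - g x)%C <= b) ->
  Cmod (Csum (map f l) - Csum (map g l))%C <= INR (length l) * b.
Proof.
  induction l as [|x l IH]; intros H.
  - simpl. replace (0 - 0)%C with (RtoC 0) by ring. rewrite Cmod_0; lra.
  - cbn [map Csum fold_right length]. rewrite S_INR.
    fold (Csum (map f l)). fold (Csum (map g l)).
    replace (f x + Csum (map f l) - (g x + Csum (map g l)))%C
      with ((f x - g x) + (Csum (map f l) - Csum (map g l)))%C by ring.
    eapply Rle_trans; [apply Cmod_triangle|].
    assert (Cmod (f x - g x)%C <= b) by (apply H; now left).
    assert (Cmod (Csum (map f l) - Csum (map g l))%C <= INR (length l) * b).
    { apply IH. intros y Hy; apply H; now right. }
    lra.
Qed.

Lemma tau_gen_expands {N : nat} (p : automorphic_data N) :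
  expands_at_0 (tau_gen p) (tau_coef p).
Proof.
  exists (1 / 4). split; [lra|]. intros s Hs. apply is_pseries_Clim.
  set (u := fun n => csum (fun k => s ^ k * tau_coef p k)%C (S n)).
  assert (Hu : forall J, Cmod (u J - tau_gen p s)%C <= INR N * 4 * (/ 2) ^ J).
  { intros J. unfold u.
    assert (E : csum (fun k => s ^ k * tau_coef p k)%C (S J)
       = (RtoC (1 / 2 * ln (INR (conductor p)))
          + Csum (map (fun kappa => csum (fun j => s ^ j * coef kappa j) (S J)) (kappas p)))%C).
    { rewrite <- Csum_csum, !(csum_head _ J). unfold tau_coef at 1.
      rewrite Csum_scal.
      rewrite (csum_ext _ (fun j => Csum (map (fun kappa => s ^ S j * coef kappa (S j))
                                              (kappas p)))%C J).
      - simpl Cpow. ring.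
      - intros j _. rewrite Csum_scal. unfold tau_coef. ring. }
    rewrite E. unfold tau_gen.
    replace (RtoC (1 / 2 * ln (INR (conductor p)))
      + Csum (map (fun kappa => csum (fun j => s ^ j * coef kappa j) (S J)) (kappas p))
      - (RtoC (1 / 2 * ln (INR (conductor p)))
         + Csum (map (fun k : C => Clogderiv GammaR (s + RtoC 1 + k)) (kappas p))))%C
      with (Csum (map (fun kappa => csum (fun j => s ^ j * coef kappa j) (S J)) (kappas p))
         - Csum (map (fun k : C => Clogderiv GammaR (s + RtoC 1 + k)) (kappas p)))%C by ring.
    rewrite Rmult_assoc.
    replace (INR N) with (INR (length (kappas p))) by (f_equal; apply size_kappas).
    apply Csum_minus_le.
    intros kappa Hin. rewrite <- Cmod_opp.
    replace (- (csum (fun j => s ^ j * coef kappa j) (S J)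
                - Clogderiv GammaR (s + RtoC 1 + kappa)))%C
      with (Clogderiv GammaR (s + RtoC 1 + kappa)
            - csum (fun j => s ^ j * coef kappa j) (S J))%C by ring.
    apply coef_expansion; [now apply (Re_kappas p) | exact Hs]. }
  assert (Hb : is_lim_seq (fun J => INR N * 4 * (/ 2) ^ J) 0).
  { replace (Finite 0) with (Rbar_mult (INR N * 4) 0)
      by (simpl; f_equal; ring).
    apply is_lim_seq_scal_l, is_lim_seq_geom. rewrite Rabs_right; lra. }
  assert (Hg : forall g : C -> R, (forall c, Rabs (g c) <= Cmod c) ->
     (forall c d, g (c - d)%C = g c - g d) ->
     is_lim_seq (fun n => g (u n)) (g (tau_gen p s))).
  { intros g Hg1 Hg2.
    apply is_lim_seq_ext with (fun n => g (u n - tau_gen p s)%C + g (tau_gen p s)).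
    { intros n. rewrite Hg2. ring. }
    replace (Finite (g (tau_gen p s))) with (Finite (0 + g (tau_gen p s)))
      by (f_equal; ring).
    apply is_lim_seq_plus'; [| apply is_lim_seq_const].
    apply is_lim_seq_abs_0. eapply is_lim_seq_le_le; [| apply is_lim_seq_const | exact Hb].
    intros n. split; [apply Rabs_pos | eapply Rle_trans; [apply Hg1 | apply Hu]]. }
  split; apply Hg; auto using re_le_Cmod, Im_le_Cmod.
Qed.

Lemma tau_eq {N : nat} (p : automorphic_data N) j : tau p j = tau_coef p j.
Proof.
  apply (expands_at_0_unique (tau_gen p)); [| apply tau_gen_expands].
  unfold tau. apply epsilon_spec. exists (tau_coef p). apply tau_gen_expands.
Qed.

(** * S_infty as a limit of sums of powers *)

Lemma sum_n_m_csum (f : nat -> C) n :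
  sum_n_m (f : nat -> C_AbelianMonoid) 1 n = csum (fun i => f (S i)) n.
Proof.
  induction n as [|n IH].
  - rewrite sum_n_m_zero by lia. reflexivity.
  - rewrite sum_n_Sm by lia. rewrite IH. reflexivity.
Qed.

Lemma binomial_Cpow (v : C) n :
  csum (fun j => RtoC (Binomial.C n j) * v ^ j)%C (S n) = ((1 + v) ^ n)%C.
Proof.
  induction n as [|n IH].
  - simpl. rewrite C_n_n. ring.
  - rewrite csum_head, C_n_0, csum_S, C_n_n, (Cpow_S (1 + v)), <- IH.
    rewrite (csum_ext _ (fun j => v * (RtoC (Binomial.C n j) * v ^ j)
                                 + RtoC (Binomial.C n (S j)) * v ^ S j)%C n).
    + rewrite csum_plus, csum_scal.
      replace ((1 + v) * csum (fun j => RtoC (Binomial.C n j) * v ^ j) (S n))%C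
        with (csum (fun j => RtoC (Binomial.C n j) * v ^ j) (S n)
              + v * csum (fun j => RtoC (Binomial.C n j) * v ^ j) (S n))%C by ring.
      rewrite csum_head at 1. rewrite C_n_0.
      rewrite (csum_S (fun j => RtoC (Binomial.C n j) * v ^ j)%C n), C_n_n.
      rewrite Cpow_S. simpl (v ^ 0)%C. ring.
    + intros j Hj. rewrite <- pascal by exact Hj. rewrite RtoC_plus, Cpow_S. ring.
Qed.

Lemma binomial_Cpow_sub1 (v : C) n :
  csum (fun i => RtoC (Binomial.C n (S i)) * v ^ S i)%C n = ((1 + v) ^ n - 1)%C.
Proof. rewrite <- binomial_Cpow, csum_head, C_n_0. simpl (v ^ 0)%C. ring. Qed.

Lemma C_n_1 n : (1 <= n)%nat -> Binomial.C n 1 = INR n.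
Proof.
  intros H. destruct n as [|n]; [lia|]. unfold Binomial.C.
  replace (S n - 1)%nat with n by lia. change (fact (S n)) with (S n * fact n)%nat.
  rewrite mult_INR. simpl (INR (fact 1)). field. apply INR_fact_neq_0.
Qed.

(** The part of [S_infty n] due to one archimedean parameter. *)
Definition T_infty (n : nat) (kappa : C) : C :=
  csum (fun i => RtoC (Binomial.C n (S i)) * coef kappa i)%C n.

(** At each finite level the sum over [j] is the binomial expansion of
    [(1 + vpole kappa k) ^ n] without its constant term. *)
Lemma Clim_T_infty n kappa : (1 <= n)%nat -> - (1 / 2) < Re kappa ->
  Clim (fun M => RtoC (INR n * ((ln (INR M) - ln PI) / 2))
                 + csum (fun k => (1 + vpole kappa k) ^ n - 1) (S M))%C
       (T_infty n kappa).
Proof.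
  intros Hn Hk.
  eapply Clim_ext;
    [| apply (Clim_csum (fun i M => RtoC (Binomial.C n (S i)) * coef_approx kappa i M)%C);
       intros i; apply Clim_mult; [apply Clim_const | now apply Clim_coef]].
  intros M; cbv beta.
  transitivity (RtoC (INR n * ((ln (INR M) - ln PI) / 2))
    + csum (fun i => csum (fun k => RtoC (Binomial.C n (S i)) * vpole kappa k ^ S i) (S M)) n)%C.
  - destruct n as [|n]; [lia|]. rewrite !(csum_head _ n). unfold coef_approx at 1.
    rewrite (csum_ext _ (fun i => csum (fun k => RtoC (Binomial.C (S n) (S (S i)))
                                    * vpole kappa k ^ S (S i)) (S M))%C n).
    + rewrite csum_scal, C_n_1, RtoC_mult by exact Hn. ring.
    + intros i _. rewrite csum_scal. unfold coef_approx. ring.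
  - f_equal. rewrite csum_exchange. apply csum_ext. intros k _. apply binomial_Cpow_sub1.
Qed.

Lemma S_infty_eq {N : nat} n (p : automorphic_data N) : (1 <= n)%nat ->
  S_infty n p = (RtoC (INR n * (1 / 2 * ln (INR (conductor p))))
                 + Csum (map (T_infty n) (kappas p)))%C.
Proof.
  intros Hn. unfold S_infty. rewrite (sum_n_m_csum (fun j => _)).
  rewrite (csum_ext _ (fun i => RtoC (Binomial.C n (S i)) * tau_coef p i)%C n).
  2: { intros i _. rewrite tau_eq. do 2 f_equal. lia. }
  assert (E : Csum (map (T_infty n) (kappas p))
    = csum (fun i => RtoC (Binomial.C n (S i))
                     * Csum (map (fun kappa => coef kappa i) (kappas p)))%C n).
  { unfold T_infty. rewrite <- Csum_csum. apply csum_ext. intros i _. apply Csum_scal. }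
  rewrite E. destruct n as [|n]; [lia|]. rewrite !(csum_head _ n).
  rewrite C_n_1, RtoC_mult by exact Hn. unfold tau_coef at 1.
  rewrite (csum_ext _ (fun i => RtoC (Binomial.C (S n) (S (S i)))
                     * Csum (map (fun kappa => coef kappa (S i)) (kappas p)))%C n).
  - ring.
  - intros i _. unfold tau_coef. ring.
Qed.

(** * Reality *)

Lemma Cconj_R (x : R) : Cconj (RtoC x) = RtoC x.
Proof. apply injective_projections; simpl; ring. Qed.

Lemma csum_conj f n : Cconj (csum f n) = csum (fun k => Cconj (f k)) n.
Proof.
  induction n as [|n IH]; simpl; [apply Cconj_R | now rewrite Cplus_conj, IH].
Qed.

Lemma Clim_conj u l : Clim u l -> Clim (fun n => Cconj (u n)) (Cconj l).
Proof.
  intros [H1 H2]; split; simpl; [exact H1 | now apply (is_lim_seq_opp _ (Im l)) in H2].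
Qed.

Lemma T_infty_conj n kappa : (1 <= n)%nat -> - (1 / 2) < Re kappa ->
  T_infty n (Cconj kappa) = Cconj (T_infty n kappa).
Proof.
  intros Hn Hk.
  assert (Hk' : - (1 / 2) < Re (Cconj kappa)) by now rewrite re_conj.
  apply (Clim_unique _ _ _ (Clim_T_infty n _ Hn Hk')).
  eapply Clim_ext; [| apply Clim_conj, (Clim_T_infty n _ Hn Hk)].
  intros M; cbv beta. rewrite Cplus_conj, Cconj_R, csum_conj. f_equal.
  apply csum_ext. intros k _.
  rewrite Cminus_conj, Cpow_conj, Cplus_conj, Cconj_R. unfold vpole.
  rewrite Copp_conj, Cinv_conj, !Cplus_conj, !Cconj_R; [reflexivity|].
  apply Cmod_gt_0. pose proof (Cmod_shift_ge kappa k Hk). pose proof (pos_INR k). lra.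
Qed.

Lemma Csum_Permutation (l l' : list C) : Permutation l l' -> Csum l = Csum l'.
Proof.
  induction 1; simpl; try congruence; try reflexivity. ring.
Qed.

Lemma Csum_conj (l : list C) : Csum (map Cconj l) = Cconj (Csum l).
Proof.
  induction l as [|x l IH]; simpl; [now rewrite Cconj_R | now rewrite IH, Cplus_conj].
Qed.

Lemma S_infty_real {N : nat} n (p : automorphic_data N) : (1 <= n)%nat ->
  Im (S_infty n p) = 0.
Proof.
  intros Hn. rewrite S_infty_eq by exact Hn.
  set (t := Csum (map (T_infty n) (kappas p))).
  assert (E : Cconj t = t).
  { unfold t at 2.
    rewrite <- (Csum_Permutation _ _ (Permutation_map (T_infty n) (conj_kappas p))).
    unfold t. rewrite <- Csum_conj, !map_map. f_equal. apply map_ext_in.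
    intros kappa Hin. symmetry. apply T_infty_conj; [exact Hn | now apply (Re_kappas p)]. }
  apply (f_equal Im) in E. rewrite im_conj in E. simpl. unfold Im in *. lra.
Qed.

(** * Moving the poles to the even integers *)

Lemma Cpow_diff_le (a b : C) (m : R) n : Cmod a <= m -> Cmod b <= m ->
  Cmod (a ^ S n - b ^ S n)%C <= INR (S n) * m ^ n * Cmod (a - b)%C.
Proof.
  intros Ha Hb. assert (Hm : 0 <= m) by (pose proof (Cmod_ge_0 a); lra).
  induction n as [|n IH].
  - replace (a ^ 1 - b ^ 1)%C with (a - b)%C by (simpl; ring). simpl; lra.
  - replace (a ^ S (S n) - b ^ S (S n))%C
      with (a * (a ^ S n - b ^ S n) + (a - b) * b ^ S n)%C by (rewrite !Cpow_S; ring).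
    eapply Rle_trans; [apply Cmod_triangle|]. rewrite !Cmod_mult, Cmod_pow.
    rewrite (S_INR (S n)).
    pose proof (pow_incr _ _ (S n) (conj (Cmod_ge_0 b) Hb)) as Hp.
    assert (Cmod a * Cmod (a ^ S n - b ^ S n)%C
            <= m * (INR (S n) * m ^ n * Cmod (a - b)%C)).
    { apply Rmult_le_compat; auto using Cmod_ge_0. }
    assert (Cmod (a - b)%C * Cmod b ^ S n <= Cmod (a - b)%C * m ^ S n).
    { apply Rmult_le_compat_l; auto using Cmod_ge_0. }
    simpl (m ^ S n) in *. lra.
Qed.

Lemma pow_diff_ge (x y : R) n : 0 <= x -> x <= y ->
  INR (S n) * x ^ n * (y - x) <= y ^ S n - x ^ S n.
Proof.
  intros Hx Hy. induction n as [|n IH]; [simpl; lra|].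
  replace (y ^ S (S n) - x ^ S (S n))
    with (y * (y ^ S n - x ^ S n) + (y - x) * x ^ S n) by (simpl; ring).
  rewrite (S_INR (S n)).
  assert (0 <= INR (S n) * x ^ n * (y - x)).
  { apply Rmult_le_pos; [| lra]. apply Rmult_le_pos; [apply pos_INR | now apply pow_le]. }
  assert (x * (INR (S n) * x ^ n * (y - x)) <= y * (y ^ S n - x ^ S n)).
  { apply Rmult_le_compat; lra. }
  simpl (x ^ S n) in *. lra.
Qed.

Lemma Cmod_sub1_sqr (w : C) : Cmod (w - 1)%C ^ 2 = Cmod w ^ 2 - 2 * Re w + 1.
Proof. rewrite !Cmod2_alt. unfold Re, Im. simpl. ring. Qed.

Lemma pow2_le_inv (x y : R) : 0 <= y -> x ^ 2 <= y ^ 2 -> x <= y.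
Proof. intros Hy H. apply Rnot_lt_le. intros Hlt. nra. Qed.

Lemma Cmod_sub1_le (w : C) : 1 / 2 <= Re w -> Cmod (w - 1)%C <= Cmod w.
Proof.
  intros H. pose proof (Cmod_sub1_sqr w). pose proof (Cmod_ge_0 w).
  apply pow2_le_inv; lra.
Qed.

(** In [|w - 1| ^ 2 = |w| ^ 2 - 2 Re w + 1] the gain [2 Re w - 1] is of order [y]
    while [|w| ^ 2] is of order [y ^ 2].  The constant 2/5 comes from
    [(4/5) |w| ^ 2 / y <= 5 y / 4 <= 2 Re w - 1], valid because [|w| <= 5 y / 4],
    [Re w >= 3 y / 4] and [y >= 4]. *)
Lemma Cmod_sub1_near_real (w : C) (y : R) : 4 <= y -> Cmod (w - RtoC y)%C <= y / 4 ->
  Cmod (w - 1)%C <= (1 - 2 / 5 * / y) * Cmod w.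
Proof.
  intros Hy Hw.
  assert (Hre : 3 / 4 * y <= Re w).
  { pose proof (re_le_Cmod (w - RtoC y)%C) as H. pose proof (Rle_abs (- Re (w - RtoC y)%C)) as H'.
    rewrite Rabs_Ropp in H'. unfold Re in *; simpl in *. lra. }
  assert (Hm : Cmod w <= 5 / 4 * y).
  { replace w with ((w - RtoC y) + RtoC y)%C by ring.
    eapply Rle_trans; [apply Cmod_triangle|]. rewrite Cmod_R, Rabs_right by lra. lra. }
  pose proof (Cmod_sub1_sqr w) as E. pose proof (Cmod_ge_0 w) as Hw0.
  assert (Hi : 0 < / y) by (apply Rinv_0_lt_compat; lra).
  assert (Hi1 : y * / y = 1) by (field; lra).
  assert (/ y <= 1) by nra.
  apply pow2_le_inv.
  - apply Rmult_le_pos; lra.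
  - rewrite Rpow_mult_distr, E.
    assert (4 / 5 * / y * Cmod w ^ 2 <= 5 / 4 * y).
    { assert (Cmod w ^ 2 <= (5 / 4 * y) ^ 2) by (apply pow_incr; lra).
      apply Rle_trans with (4 / 5 * / y * (5 / 4 * y) ^ 2).
      - apply Rmult_le_compat_l; lra.
      - right. field. lra. }
    assert (0 <= (2 / 5 * / y) ^ 2 * Cmod w ^ 2).
    { apply Rmult_le_pos; apply pow2_ge_0. }
    nra.
Qed.

(** A common bound for [|1 - 1 / w_k|] and [1 - 1 / (2 k + 2)] when [k] is large
    compared with [|kappa|]. *)
Definition damp (k : nat) : R := 1 - 2 / 5 * / (2 * INR k + 2).

Lemma damp_bounds k : 0 <= damp k <= 1.
Proof.
  unfold damp. pose proof (pos_INR k).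
  assert (0 < / (2 * INR k + 2)) by (apply Rinv_0_lt_compat; lra).
  assert (/ (2 * INR k + 2) <= / 2) by (apply Rinv_le_contravar; lra).
  lra.
Qed.

Lemma damp_step k : 2 / 5 * / (2 * INR k + 2) ^ 2 <= damp (S k) - damp k.
Proof.
  unfold damp. rewrite S_INR. pose proof (pos_INR k).
  assert (E : 1 - 2 / 5 * / (2 * (INR k + 1) + 2) - (1 - 2 / 5 * / (2 * INR k + 2))
              - 2 / 5 * / (2 * INR k + 2) ^ 2
              = 2 / 5 * (INR k * / ((INR k + 2) * (2 * INR k + 2) ^ 2))).
  { field. lra. }
  assert (0 < / ((INR k + 2) * (2 * INR k + 2) ^ 2)).
  { apply Rinv_0_lt_compat. apply Rmult_lt_0_compat; [lra | apply pow_lt; lra]. }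
  nra.
Qed.

Lemma vpole_pow_diff_small kappa n k : - (1 / 2) < Re kappa ->
  Cmod ((1 + vpole kappa k) ^ n - RtoC (1 - / (2 * INR k + 2)) ^ n)%C <= 2.
Proof.
  intros Hk. pose proof (pos_INR k).
  set (w := (1 + kappa + RtoC (2 * INR k))%C).
  assert (Nw : w <> RtoC 0).
  { apply Cmod_gt_0. pose proof (Cmod_shift_ge kappa k Hk). unfold w. lra. }
  assert (Ea : (1 + vpole kappa k)%C = ((w - 1) / w)%C).
  { unfold vpole. fold w. field. exact Nw. }
  assert (Ha : Cmod (1 + vpole kappa k)%C <= 1).
  { rewrite Ea, Cmod_div by exact Nw. apply Rle_div_l; [now apply Cmod_gt_0|].
    rewrite Rmult_1_l. apply Cmod_sub1_le. unfold w, Re in *; simpl; lra. }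
  assert (Hb : Cmod (RtoC (1 - / (2 * INR k + 2))) <= 1).
  { rewrite Cmod_R. assert (0 < / (2 * INR k + 2)) by (apply Rinv_0_lt_compat; lra).
    assert (/ (2 * INR k + 2) <= / 2) by (apply Rinv_le_contravar; lra).
    apply Rabs_le; lra. }
  eapply Rle_trans; [apply Cmod_minus_le|]. rewrite !Cmod_pow.
  pose proof (pow_incr _ _ n (conj (Cmod_ge_0 _) Ha)).
  pose proof (pow_incr _ _ n (conj (Cmod_ge_0 _) Hb)).
  rewrite pow1 in *. lra.
Qed.

(** The bases differ by [(kappa - 1) / (w_k (2 k + 2))], which is [O((|kappa| + 1) / k ^ 2)];
    the increments of [damp] are at least a multiple of [1 / k ^ 2], so the difference of
    powers is absorbed by an increment of [damp k ^ (n + 1)]. *)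
Lemma vpole_pow_diff_large kappa n k : - (1 / 2) < Re kappa ->
  4 * (Cmod kappa + 1) <= 2 * INR k + 2 ->
  Cmod ((1 + vpole kappa k) ^ S n - RtoC (1 - / (2 * INR k + 2)) ^ S n)%C
  <= 10 / 3 * (Cmod kappa + 1) * (damp (S k) ^ S n - damp k ^ S n).
Proof.
  intros Hk Hy. pose proof (Cmod_ge_0 kappa) as Hk0.
  pose proof (damp_step k) as Hstep. pose proof (damp_bounds k) as Hd.
  set (y := 2 * INR k + 2) in *. set (c := Cmod kappa + 1) in *.
  set (w := (1 + kappa + RtoC (2 * INR k))%C).
  assert (Ewy : (w - RtoC y)%C = (kappa - 1)%C).
  { unfold w, y. apply injective_projections; simpl; ring. }
  assert (Hwy : Cmod (w - RtoC y)%C <= c).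
  { rewrite Ewy. eapply Rle_trans; [apply Cmod_minus_le|]. rewrite Cmod_1.
    unfold c; lra. }
  assert (Hy4 : 4 <= y) by (unfold c in Hy; lra).
  assert (Hw : 3 / 4 * y <= Cmod w).
  { pose proof (Cmod_minus_le w (w - RtoC y)) as T2.
    replace (w - (w - RtoC y))%C with (RtoC y) in T2 by ring.
    rewrite Cmod_R, Rabs_right in T2 by lra. lra. }
  assert (Nw : w <> RtoC 0) by (apply Cmod_gt_0; lra).
  assert (Ny : RtoC y <> RtoC 0) by (intros E; injection E; lra).
  assert (Ea : (1 + vpole kappa k)%C = ((w - 1) / w)%C).
  { unfold vpole. fold w. field. exact Nw. }
  assert (Ha : Cmod (1 + vpole kappa k)%C <= damp k).
  { rewrite Ea, Cmod_div by exact Nw. apply Rle_div_l; [now apply Cmod_gt_0|].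
    apply (Cmod_sub1_near_real w y); [exact Hy4 | lra]. }
  assert (Hi : 0 < / y) by (apply Rinv_0_lt_compat; lra).
  assert (Hi1 : / y <= 1) by (rewrite <- Rinv_1; apply Rinv_le_contravar; lra).
  assert (Hb : Cmod (RtoC (1 - / y)) <= damp k).
  { rewrite Cmod_R, Rabs_right by lra. unfold damp. fold y. lra. }
  eapply Rle_trans; [apply (Cpow_diff_le _ _ _ n Ha Hb)|].
  assert (Hab : Cmod (1 + vpole kappa k - RtoC (1 - / y))%C <= 10 / 3 * c * (damp (S k) - damp k)).
  { replace (1 + vpole kappa k - RtoC (1 - / y))%C with ((w - RtoC y) / (RtoC y * w))%C.
    - rewrite Cmod_div, Cmod_mult, Cmod_R, Rabs_right by (try lra; now apply Cmult_neq_0).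
      apply Rle_trans with (c / (y * (3 / 4 * y))).
      + apply Rmult_le_compat; auto using Cmod_ge_0.
        * left; apply Rinv_0_lt_compat. apply Rmult_lt_0_compat; lra.
        * apply Rinv_le_contravar; [nra|]. apply Rmult_le_compat_l; lra.
      + replace (c / (y * (3 / 4 * y))) with (10 / 3 * c * (2 / 5 * / y ^ 2)) by (field; lra).
        apply Rmult_le_compat_l; [unfold c; lra | exact Hstep].
    - rewrite Ea, RtoC_minus, RtoC_inv by lra. field. now split. }
  assert (Hdd : damp k <= damp (S k)).
  { assert (0 <= 2 / 5 * / y ^ 2).
    { apply Rmult_le_pos; [lra|]. left; apply Rinv_0_lt_compat; nra. }
    lra. }
  pose proof (pow_diff_ge (damp k) (damp (S k)) n (proj1 Hd) Hdd) as Hp.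
  assert (0 <= INR (S n) * damp k ^ n).
  { apply Rmult_le_pos; [apply pos_INR | now apply pow_le]. }
  apply Rle_trans with (INR (S n) * damp k ^ n * (10 / 3 * c * (damp (S k) - damp k))).
  { apply Rmult_le_compat_l; assumption. }
  assert (0 <= 10 / 3 * c) by (unfold c; lra). nra.
Qed.

Lemma rsum_plus f g n : rsum (fun k => f k + g k) n = rsum f n + rsum g n.
Proof. induction n as [|n IH]; simpl; [ring | rewrite IH; ring]. Qed.

Lemma vpole_pow_sum_diff kappa n M : - (1 / 2) < Re kappa -> (1 <= n)%nat ->
  Cmod (csum (fun k => (1 + vpole kappa k) ^ n
                       - RtoC (1 - / (2 * INR k + 2)) ^ n)%C M)
  <= 8 * (Cmod kappa + 1).
Proof.
  intros Hk Hn. destruct n as [|n]; [lia|]. pose proof (Cmod_ge_0 kappa) as Hk0.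
  set (c := Cmod kappa + 1).
  (* twice the indicator of the small indices, of which there are at most 2 c *)
  set (few := fun k => if Rlt_dec (2 * INR k + 2) (4 * c) then 2 else 0).
  assert (Hfew : rsum few M <= 4 * c).
  { assert (H : rsum few M <= 2 * INR M /\ rsum few M <= 4 * c).
    { induction M as [|M [IH1 IH2]]; [simpl; unfold c; lra|].
      change (rsum few (S M)) with (rsum few M + few M). rewrite S_INR. unfold few at 2 4.
      destruct (Rlt_dec (2 * INR M + 2) (4 * c)); lra. }
    apply H. }
  eapply Rle_trans.
  { apply csum_Cmod_le with
      (g := fun k => few k + 10 / 3 * c * (damp (S k) ^ S n - damp k ^ S n)).
    intros k _. unfold few. destruct (Rlt_dec (2 * INR k + 2) (4 * c)) as [Hs | Hl].
    - pose proof (vpole_pow_diff_small kappa (S n) k Hk).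
      assert (0 <= damp (S k) ^ S n - damp k ^ S n).
      { pose proof (damp_step k). pose proof (pos_INR k). pose proof (damp_bounds k).
        assert (0 <= 2 / 5 * / (2 * INR k + 2) ^ 2).
        { apply Rmult_le_pos; [lra|]. left; apply Rinv_0_lt_compat; nra. }
        pose proof (pow_incr (damp k) (damp (S k)) (S n)). lra. }
      assert (0 <= 10 / 3 * c) by (unfold c; lra). nra.
    - rewrite Rplus_0_l. apply vpole_pow_diff_large; [exact Hk | unfold c in Hl; lra]. }
  rewrite rsum_plus, rsum_scal, (rsum_telescope (fun k => damp k ^ S n)).
  pose proof (pow_incr (damp M) 1 (S n) (damp_bounds M)) as H1. rewrite pow1 in H1.
  pose proof (pow_le (damp 0) (S n) (proj1 (damp_bounds 0))) as H2.
  assert (0 < c) by (unfold c; lra). nra.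
Qed.

(** * The sum over the even integers *)

Definition logpart (k : nat) (u : R) : R :=
  rsum (fun j => (1 - / (2 * u)) ^ S j / INR (S j)) k.

(** An antiderivative of [(1 - 1 / (2 u)) ^ n - 1].  Its increment from [n] to [n + 1]
    has derivative [- (1 - 1 / (2 u)) ^ n / (2 u)], and peeling off factors of
    [1 - 1 / (2 u)] from this one leads to the truncated logarithmic series. *)
Definition Fref (n : nat) (u : R) : R :=
  rsum (fun k => 1 / 2 * logpart k u - 1 / 2 * ln u) n.

Lemma is_derive_logpart k u : 0 < u ->
  is_derive (logpart k) u ((1 - (1 - / (2 * u)) ^ k) / u).
Proof.
  intros Hu. induction k as [|k IH].
  - unfold logpart; simpl. replace ((1 - 1) / u) with 0 by (field; lra).
    apply @is_derive_const.
  - apply is_derive_ext with (fun v => logpart k v + (1 - / (2 * v)) ^ S k / INR (S k)).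
    { reflexivity. }
    replace ((1 - (1 - / (2 * u)) ^ S k) / u)
      with ((1 - (1 - / (2 * u)) ^ k) / u + (1 - / (2 * u)) ^ k / (2 * u ^ 2))
      by (simpl; field; lra).
    apply (is_derive_plus (logpart k)); [exact IH|].
    auto_derive; [lra|]. pose proof (pos_INR k).
    change (match k with O => 1 | S _ => INR k + 1 end) with (INR (S k)).
    rewrite S_INR. simpl. fold (1 - / (2 * u)).
    generalize ((1 - / (2 * u)) ^ k). intros q. field. lra.
Qed.

Lemma is_derive_Fref n u : 0 < u ->
  is_derive (Fref n) u ((1 - / (2 * u)) ^ n - 1).
Proof.
  intros Hu. induction n as [|n IH].
  - unfold Fref; simpl. replace (1 - 1) with 0 by ring. apply @is_derive_const.
  - apply is_derive_ext with (fun v => Fref n v + (1 / 2 * logpart n v - 1 / 2 * ln v)).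
    { reflexivity. }
    replace ((1 - / (2 * u)) ^ S n - 1)
      with ((1 - / (2 * u)) ^ n - 1
            + (1 / 2 * ((1 - (1 - / (2 * u)) ^ n) / u) - 1 / 2 * / u))
      by (simpl; field; lra).
    apply (is_derive_plus (Fref n)); [exact IH|].
    apply (is_derive_minus (fun v => 1 / 2 * logpart n v)).
    + apply (is_derive_scal (logpart n)). now apply is_derive_logpart.
    + apply (is_derive_scal ln). auto_derive; lra.
Qed.

Lemma Fref_slope n a b : 1 / 2 <= a -> a <= b ->
  ((1 - / (2 * a)) ^ n - 1) * (b - a) <= Fref n b - Fref n a
  <= ((1 - / (2 * b)) ^ n - 1) * (b - a).
Proof.
  intros Ha Hab.
  destruct (MVT_gen (Fref n) a b (fun u => (1 - / (2 * u)) ^ n - 1)) as [c [Hc E]].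
  - intros x Hx. rewrite Rmin_left in Hx by lra. apply is_derive_Fref; lra.
  - intros x Hx. rewrite Rmin_left in Hx by lra.
    apply derivable_continuous_pt. eexists. apply is_derive_Reals, is_derive_Fref. lra.
  - rewrite Rmin_left, Rmax_right in Hc by lra. rewrite E.
    assert (Hmono : forall x y, 1 / 2 <= x -> x <= y ->
              (1 - / (2 * x)) ^ n <= (1 - / (2 * y)) ^ n).
    { intros x y Hx Hxy. apply pow_incr.
      assert (/ (2 * y) <= / (2 * x)) by (apply Rinv_le_contravar; lra).
      assert (/ (2 * x) <= 1) by (rewrite <- Rinv_1; apply Rinv_le_contravar; lra).
      lra. }
    pose proof (Hmono a c Ha (proj1 Hc)).
    pose proof (Hmono c b (Rle_trans _ _ _ Ha (proj1 Hc)) (proj2 Hc)).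
    split; apply Rmult_le_compat_r; lra.
Qed.

Lemma one_sub_inv_pow_bounds n u : 1 / 2 <= u -> 0 <= (1 - / (2 * u)) ^ n <= 1.
Proof.
  intros Hu. assert (0 < / (2 * u)) by (apply Rinv_0_lt_compat; lra).
  assert (/ (2 * u) <= 1) by (rewrite <- Rinv_1; apply Rinv_le_contravar; lra).
  split; [apply pow_le; lra|]. pose proof (pow_incr (1 - / (2 * u)) 1 n) as H1.
  rewrite pow1 in H1. apply H1; lra.
Qed.

(** Each increment of [Fref] over a unit interval lies between consecutive terms of
    the sum, because the derivative is increasing; the two bounds differ by the
    difference of the last and first terms. *)
Lemma ref_sum_Fref n K :
  Rabs (rsum (fun k => (1 - / (2 * INR k + 2)) ^ n - 1) K
        - (Fref n (INR K + 1) - Fref n 1)) <= 1.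
Proof.
  set (phi := fun k => (1 - / (2 * INR k + 2)) ^ n - 1).
  assert (Hphi : forall k, phi k = (1 - / (2 * (INR k + 1))) ^ n - 1).
  { intros k. unfold phi. do 4 f_equal. ring. }
  assert (H : rsum phi K <= Fref n (INR K + 1) - Fref n 1 <= rsum phi K + phi K - phi 0%nat).
  { induction K as [|K IH].
    - simpl. rewrite Rplus_0_l. lra.
    - change (rsum phi (S K)) with (rsum phi K + phi K).
      pose proof (pos_INR K).
      pose proof (Fref_slope n (INR K + 1) (INR K + 1 + 1)) as Hs.
      specialize (Hs ltac:(lra) ltac:(lra)).
      pose proof (Hphi K) as E1. pose proof (Hphi (S K)) as E2. rewrite S_INR in E2.
      rewrite <- E1, <- E2 in Hs.
      replace (INR K + 1 + 1 - (INR K + 1)) with 1 in Hs by ring.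
      rewrite S_INR. lra. }
  pose proof (one_sub_inv_pow_bounds n (INR K + 1)) as B1.
  pose proof (one_sub_inv_pow_bounds n (INR 0 + 1)) as B2.
  pose proof (pos_INR K). specialize (B1 ltac:(lra)). specialize (B2 ltac:(simpl; lra)).
  rewrite !Hphi in H. apply Rabs_le. lra.
Qed.

Definition harmonic (n : nat) : R := rsum (fun j => / INR (S j)) n.

Lemma rsum_harmonic n : rsum harmonic n = INR n * harmonic n - INR n.
Proof.
  induction n as [|n IH]; [simpl; ring|].
  change (rsum harmonic (S n)) with (rsum harmonic n + harmonic n).
  change (harmonic (S n)) with (harmonic n + / INR (S n)).
  rewrite IH, S_INR. pose proof (pos_INR n). field. lra.
Qed.

(** At [u = 1/2] the base [1 - 1 / (2 u)] vanishes. *)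
Lemma Fref_half n : Fref n (1 / 2) = INR n / 2 * ln 2.
Proof.
  assert (HP : forall k, logpart k (1 / 2) = 0).
  { induction k as [|k IH]; [reflexivity|].
    change (logpart (S k) (1 / 2))
      with (logpart k (1 / 2) + (1 - / (2 * (1 / 2))) ^ S k / INR (S k)).
    rewrite IH. replace (1 - / (2 * (1 / 2))) with 0 by field.
    rewrite pow_ne_zero by lia. unfold Rdiv; ring. }
  induction n as [|n IH]; [unfold Fref; simpl; field|].
  change (Fref (S n) (1 / 2))
    with (Fref n (1 / 2) + (1 / 2 * logpart n (1 / 2) - 1 / 2 * ln (1 / 2))).
  rewrite IH, HP, S_INR. replace (1 / 2) with (/ 2) at 3 by field.
  rewrite ln_Rinv by lra. field.
Qed.

Lemma Fref_1 n : Rabs (Fref n 1 - INR n / 2 * ln 2) <= 1 / 2.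
Proof.
  rewrite <- Fref_half. pose proof (Fref_slope n (1 / 2) 1) as H.
  specialize (H ltac:(lra) ltac:(lra)).
  pose proof (one_sub_inv_pow_bounds n (1 / 2) ltac:(lra)).
  pose proof (one_sub_inv_pow_bounds n 1 ltac:(lra)).
  apply Rabs_le. lra.
Qed.

Lemma is_lim_seq_rsum (u : nat -> nat -> R) (l : nat -> R) n :
  (forall k, is_lim_seq (u k) (l k)) ->
  is_lim_seq (fun M => rsum (fun k => u k M) n) (rsum l n).
Proof.
  intros H. induction n as [|n IH]; simpl;
    [apply is_lim_seq_const | now apply is_lim_seq_plus'].
Qed.

Lemma is_lim_seq_pow_fixed u (l : R) n :
  is_lim_seq u l -> is_lim_seq (fun M => u M ^ n) (l ^ n).
Proof.
  intros H. induction n as [|n IH]; simpl;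
    [apply is_lim_seq_const | now apply is_lim_seq_mult'].
Qed.

Lemma is_lim_seq_inv_succ : is_lim_seq (fun n => / (INR n + 1)) 0.
Proof.
  apply is_lim_seq_ext with (fun n => / INR (S n)).
  { intros n. now rewrite S_INR. }
  apply (is_lim_seq_incr_1 (fun n => / INR n)).
  apply (is_lim_seq_inv INR p_infty is_lim_seq_INR). discriminate.
Qed.

Lemma is_lim_seq_lstep : is_lim_seq lstep 0.
Proof.
  apply is_lim_seq_le_le with (fun _ => 0) (fun n => 2 * / (INR n + 1)).
  - intros n. apply lstep_le.
  - apply is_lim_seq_const.
  - replace (Finite 0) with (Rbar_mult 2 0) by (simpl; f_equal; ring).
    apply is_lim_seq_scal_l, is_lim_seq_inv_succ.
Qed.

(** The divergent part of [Fref n u] is [- (n / 2) ln u], and the truncated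
    logarithmic series tend to harmonic numbers. *)
Lemma is_lim_seq_Fref n :
  is_lim_seq (fun M => INR n / 2 * ln (INR M) + Fref n (INR (S M) + 1))
             (1 / 2 * (INR n * harmonic n - INR n)).
Proof.
  rewrite <- rsum_harmonic.
  apply is_lim_seq_ext with (fun M =>
    1 / 2 * rsum (fun k => logpart k (INR (S M) + 1)) n
    - INR n / 2 * (lstep (S M) + lstep M)).
  { intros M. unfold Fref, lstep. rewrite <- (S_INR (S M)).
    set (u := INR (S (S M))). generalize (ln (INR (S M))). intros x.
    induction n as [|n IH]; [simpl; unfold Rdiv; ring|].
    change (rsum (fun k => logpart k u) (S n)) with (rsum (fun k => logpart k u) n + logpart n u).
    change (rsum (fun k => 1 / 2 * logpart k u - 1 / 2 * ln u) (S n))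
      with (rsum (fun k => 1 / 2 * logpart k u - 1 / 2 * ln u) n
            + (1 / 2 * logpart n u - 1 / 2 * ln u)).
    rewrite S_INR. lra. }
  replace (1 / 2 * rsum harmonic n)
    with (1 / 2 * rsum harmonic n - INR n / 2 * (0 + 0)) by ring.
  apply is_lim_seq_minus'.
  - apply (is_lim_seq_scal_l _ (1 / 2) (rsum harmonic n)).
    apply (is_lim_seq_rsum (fun k M => logpart k (INR (S M) + 1))).
    intros k. unfold logpart, harmonic.
    apply (is_lim_seq_rsum (fun j M => (1 - / (2 * (INR (S M) + 1))) ^ S j / INR (S j))).
    intros j. replace (/ INR (S j)) with (1 ^ S j * / INR (S j)) by (rewrite pow1; ring).
    apply is_lim_seq_mult'; [| apply is_lim_seq_const].
    apply is_lim_seq_pow_fixed.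
    replace (Finite 1) with (Finite (1 - / 2 * 0)) by (f_equal; ring).
    apply is_lim_seq_minus'; [apply is_lim_seq_const|].
    apply is_lim_seq_ext with (fun M => / 2 * / (INR (S M) + 1)).
    { intros M. pose proof (pos_INR (S M)). field. lra. }
    apply (is_lim_seq_scal_l _ (/ 2) 0).
    apply (is_lim_seq_incr_1 (fun n => / (INR n + 1))). apply is_lim_seq_inv_succ.
  - apply (is_lim_seq_scal_l _ (INR n / 2) (0 + 0)).
    apply is_lim_seq_plus'; [apply (is_lim_seq_incr_1 lstep)|]; apply is_lim_seq_lstep.
Qed.

(** * Euler's constant *)

Lemma sum_n_m_harmonic n : sum_n_m (fun k => / INR k) 1 n = harmonic n.
Proof.
  induction n as [|n IH].
  - rewrite sum_n_m_zero by lia. reflexivity.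
  - rewrite sum_n_Sm by lia. rewrite IH. reflexivity.
Qed.

Lemma is_lim_seq_gamma_Euler :
  is_lim_seq (fun n => harmonic n - ln (INR n)) gamma_Euler.
Proof.
  apply is_lim_seq_ext with (fun n => sum_n_m (fun k => / INR k) 1 n - ln (INR n)).
  { intros n. now rewrite sum_n_m_harmonic. }
  apply Lim_seq_correct', ex_lim_seq_dominated with (fun n => 4 * rsum tel n).
  - intros n. rewrite !sum_n_m_harmonic.
    change (harmonic (S n)) with (harmonic n + / INR (S n)).
    change (rsum tel (S n)) with (rsum tel n + tel n).
    replace (harmonic n + / INR (S n) - ln (INR (S n)) - (harmonic n - ln (INR n)))
      with (- (lstep n - / (INR n + 1))) by (unfold lstep; rewrite (S_INR n); ring).
    rewrite Rabs_Ropp. pose proof (lstep_harmonic n). lra.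
  - apply ex_lim_tel_sum.
Qed.

(** [harmonic m - ln m] decreases while [harmonic m - ln m - 1 / m] increases, by the
    two bounds on [lstep]. *)
Lemma gamma_Euler_bounds n : (1 <= n)%nat ->
  0 <= INR n * (harmonic n - ln (INR n) - gamma_Euler) <= 1.
Proof.
  intros Hn. set (u := fun n => harmonic n - ln (INR n)).
  assert (Hstep : forall m, u (S (S m)) = u (S m) + / INR (S (S m)) - lstep (S m)).
  { intros m. unfold u, lstep.
    change (harmonic (S (S m))) with (harmonic (S m) + / INR (S (S m))). ring. }
  assert (Hm : forall m, (n <= m)%nat -> u m <= u n /\ u n - / INR n <= u m - / INR m).
  { intros m Hm. induction Hm as [|m Hm IH]; [lra|].
    destruct m as [|m]; [lia|]. pose proof (lstep_bounds m) as B.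
    rewrite <- (S_INR (S m)) in B. rewrite Hstep. lra. }
  assert (Hg : is_lim_seq (fun m => u (m + n)%nat) gamma_Euler).
  { apply (is_lim_seq_incr_n u n). apply is_lim_seq_gamma_Euler. }
  assert (H1 : gamma_Euler <= u n).
  { apply (is_lim_seq_le _ _ _ _ (fun m => proj1 (Hm (m + n)%nat ltac:(lia))) Hg
             (is_lim_seq_const (u n))). }
  assert (Hpos : 0 < INR n) by (apply lt_0_INR; lia).
  assert (H2 : u n - / INR n <= gamma_Euler).
  { refine (is_lim_seq_le _ _ _ _ _ (is_lim_seq_const (u n - / INR n)) Hg).
    intros m. destruct (Hm (m + n)%nat ltac:(lia)) as [_ H].
    assert (0 < / INR (m + n)) by (apply Rinv_0_lt_compat, lt_0_INR; lia). lra. }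
  fold (u n). assert (E : INR n * / INR n = 1) by (field; lra). nra.
Qed.

(** * The asymptotic formula *)

Lemma RtoC_rsum f n : RtoC (rsum f n) = csum (fun k => RtoC (f k)) n.
Proof. induction n as [|n IH]; simpl; [reflexivity | now rewrite RtoC_plus, IH]. Qed.

(** The parts [8 (|kappa| + 1)] and [1] come from moving the poles and from
    comparing the sum with [Fref]; the last [1] bounds the errors of [harmonic n] and
    of [Fref n 1] against [Fref n (1 / 2)]. *)
Lemma T_infty_asymptotic n kappa : (1 <= n)%nat -> - (1 / 2) < Re kappa ->
  Cmod (T_infty n kappa
        - RtoC (1 / 2 * (INR n * ln (INR n))
                + INR n / 2 * (gamma_Euler - 1 - ln (2 * PI))))%C
  <= 10 * (Cmod kappa + 1).
Proof.
  intros Hn Hk. pose proof (Cmod_ge_0 kappa) as Hk0.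
  (* the limit in M of n log (M / pi) / 2 + Fref n (M + 2) - Fref n 1 *)
  set (rho := 1 / 2 * (INR n * harmonic n - INR n) - Fref n 1 - INR n / 2 * ln PI).
  assert (H1 : Cmod (T_infty n kappa - RtoC rho)%C <= 8 * (Cmod kappa + 1) + 1).
  { apply Clim_Cmod_le with (fun M =>
      RtoC (INR n * ((ln (INR M) - ln PI) / 2))
      + csum (fun k => (1 + vpole kappa k) ^ n - 1) (S M)
      - RtoC (INR n / 2 * ln (INR M) + Fref n (INR (S M) + 1) - Fref n 1
              - INR n / 2 * ln PI))%C.
    - apply Clim_minus; [now apply Clim_T_infty|]. apply Clim_RtoC.
      apply is_lim_seq_minus'; [| apply is_lim_seq_const].
      apply is_lim_seq_minus'; [apply is_lim_seq_Fref | apply is_lim_seq_const].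
    - intros M.
      set (d := csum (fun k => (1 + vpole kappa k) ^ n
                       - RtoC (1 - / (2 * INR k + 2)) ^ n)%C (S M)).
      set (e := rsum (fun k => (1 - / (2 * INR k + 2)) ^ n - 1) (S M)
                - (Fref n (INR (S M) + 1) - Fref n 1)).
      assert (Es : csum (fun k => (1 + vpole kappa k) ^ n - 1)%C (S M)
              = (d + RtoC (rsum (fun k => (1 - / (2 * INR k + 2)) ^ n - 1)%R (S M)))%C).
      { unfold d. rewrite RtoC_rsum, <- csum_plus. apply csum_ext. intros k _.
        rewrite (RtoC_minus (_ ^ n)), RtoC_pow. ring. }
      replace (RtoC (INR n * ((ln (INR M) - ln PI) / 2))
        + csum (fun k => (1 + vpole kappa k) ^ n - 1) (S M)
        - RtoC (INR n / 2 * ln (INR M) + Fref n (INR (S M) + 1) - Fref n 1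
              - INR n / 2 * ln PI))%C with (d + RtoC e)%C.
      + eapply Rle_trans; [apply Cmod_triangle|].
        apply Rplus_le_compat; [now apply vpole_pow_sum_diff|].
        rewrite Cmod_R. apply ref_sum_Fref.
      + rewrite Es. unfold e. apply injective_projections; simpl; field. }
  set (t := 1 / 2 * (INR n * ln (INR n)) + INR n / 2 * (gamma_Euler - 1 - ln (2 * PI))).
  assert (H2 : Rabs (rho - t) <= 1).
  { unfold rho, t. rewrite ln_mult by (try apply PI_RGT_0; lra).
    pose proof (gamma_Euler_bounds n Hn) as Hg. pose proof (Fref_1 n) as HF.
    apply Rabs_le_between in HF. apply Rabs_le. nra. }
  replace (T_infty n kappa - RtoC t)%C
    with ((T_infty n kappa - RtoC rho) + RtoC (rho - t))%C
    by (rewrite RtoC_minus; ring).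
  eapply Rle_trans; [apply Cmod_triangle|]. rewrite Cmod_R. lra.
Qed.

Lemma Cmod_sqr_le_K_const {N : nat} (p : automorphic_data N) kappa :
  In kappa (kappas p) -> Cmod kappa ^ 2 <= K_const p.
Proof.
  unfold K_const. induction (kappas p) as [|x l IH]; simpl; [tauto|].
  intros [-> | H]; [apply Rmax_l | eapply Rle_trans; [now apply IH | apply Rmax_r]].
Qed.

Lemma Csum_const (c : C) (l : list C) :
  Csum (map (fun _ => c) l) = (RtoC (INR (length l)) * c)%C.
Proof.
  induction l as [|x l IH]; [simpl; ring|].
  cbn [map Csum fold_right length]. fold (Csum (map (fun _ : C => c) l)).
  rewrite IH, S_INR, RtoC_plus. ring.
Qed.

Theorem theorem5p1 :
  exists A : R,
    forall (N : nat) (p : automorphic_data N),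
      (1 <= N)%nat ->
      (forall n : nat, (1 <= n)%nat -> Im (S_infty n p) = 0) /\
      (forall n : nat, (1 <= n)%nat -> K_const p <= INR n ->
         Cmod (S_infty n p
               - RtoC (INR N / 2 * (INR n * ln (INR n)) + C_1 p * INR n))%C
         <= A * (INR N * (K_const p + 1))).
Proof.
  exists 20. intros N p _. split; [intros n Hn; now apply S_infty_real|].
  intros n Hn _.
  set (t := 1 / 2 * (INR n * ln (INR n)) + INR n / 2 * (gamma_Euler - 1 - ln (2 * PI))).
  assert (EN : INR (length (kappas p)) = INR N) by (f_equal; apply size_kappas).
  replace (S_infty n p - RtoC (INR N / 2 * (INR n * ln (INR n)) + C_1 p * INR n))%C
    with (Csum (map (T_infty n) (kappas p)) - Csum (map (fun _ => RtoC t) (kappas p)))%C.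
  - rewrite <- Rmult_assoc, (Rmult_comm 20), Rmult_assoc, <- EN.
    apply Csum_minus_le. intros kappa Hin.
    eapply Rle_trans; [apply T_infty_asymptotic; [exact Hn | now apply (Re_kappas p)]|].
    pose proof (Cmod_sqr_le_K_const p kappa Hin). nra.
  - rewrite Csum_const, EN, S_infty_eq by exact Hn.
    unfold C_1, t. apply injective_projections; simpl; field.
Qed.
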